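(* For every treelike snark $G$, $scc(G)>\frac{4}{3}\cdot|E(G)|$.
   Context: Graphs may contain parallel edges but no loops; bridgeless means $2$-edge-connected. A cycle is an even subgraph (a subgraph all of whose degrees are even). A cycle cover of $G$ is a family $\mathcal{C}$ of cycles of $G$ such that every edge of $G$ is contained in at least one cycle of $\mathcal{C}$; its length is the sum of the numbers of edges of the cycles in $\mathcal{C}$. $scc(G)$ is the minimum length of a cycle cover of $G$. A multigraph is Class I if its chromatic index equals its maximum degree. For a perfect matching $M$ of $G$ and an integer $t\ge 0$, $G+tM$ is the multigraph obtained from $G$ by adding $t$ parallel edges to every edge of $M$. $l_M(G)$ is the minimum $t\ge 0$ such that $G+tM$ is Class I, and $l_M(G)=+\infty$ if no such $t$ exists. A bridgeless cubic graph $G$ is frumious if $l_M(G)=+\infty$ for all perfect matchings $M$ of $G$. A snark is a bridgeless cubic graph with chromatic index $4$ (every frumious graph is a snark). A dangling edge is an edge having exactly one end-vertex. A $4$-pole is what is obtained from a vertex subset $U$ of a cubic graph with exactly four edges leaving $U$, by taking the subgraph induced by $U$ together with these four edges as dangling edges (so each vertex has degree $3$, counting dangling edges). Joining a dangling edge with end-vertex $x$ to a vertex $y$ means deleting the dangling edge and making $x$ and $y$ adjacent. Let $A$ be a $4$-pole whose four dangling edges are partitioned into ordered pairs $(l_1,l_2)$ (first and second left dangling edges) and $(r_1,r_2)$ (first and second right dangling edges), and let $u_1,u_2,v_1,v_2$ be the end-vertices of $l_1,l_2,r_1,r_2$, respectively. $A$ is frumious (with respect to this partition) if the graph obtained by removing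 the four dangling edges and adding two new vertices $u,v$, with $u$ adjacent to $v,u_1,u_2$ and $v$ adjacent to $u,v_1,v_2$, is a frumious snark. A Halin graph is a plane graph consisting of a planar representation of a tree without degree $2$ vertices and a circuit on the set of its leaves. Let $H$ be a cubic Halin graph consisting of the tree $T$ and the circuit $K$. A treelike snark is any cubic graph that can be obtained as follows: start from $T$; for every leaf $x$ of $T$ add two new vertices $x_1,x_2$ and the edges $xx_1,xx_2$; for every edge $xy$ of $K$, with $x$ the predecessor of $y$ in the clockwise orientation of $K$, replace the edge $xy$ with a frumious $4$-pole (possibly different ones for different edges), joining its first and second left dangling edges to $x_1$ and $x_2$, respectively, and its first and second right dangling edges to $y_1$ and $y_2$, respectively. *)

(* Defs.v *)
From mathcomp Require Import all_boot fingroup perm.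
From mathcomp Require Import boolp.

Set Implicit Arguments.
Unset Strict Implicit.
Unset Printing Implicit Defensive.

(* [minimum P] is the least n with [P n], and [None] (read +oo) if there is
   no such n. *)
Definition minimum (P : nat -> Prop) : option nat :=
  if pselect (exists n, `[< P n >]) is left exP then Some (ex_minn exP)
  else None.

(** * Finite multigraphs: parallel edges allowed, loops excluded *)

(* The booleans name the two ends of an edge, in no significant order. *)
Record mgraph := MGraph {
  vert : finType;
  edge : finType;
  endp : edge -> bool -> vert;
  endp_neq : forall e, endp e false != endp e true }.

Section Graphs.
Variable G : mgraph.
Implicit Types (F C M : {set edge G}) (e f : edge G) (x y v : vert G).

Definition ends e : {set vert G} := [set endp e b | b : bool].

Definition degin F v : nat := #|[set e in F | v \in ends e]|.
Definition degree v : nat := degin setT v.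
Definition maxdegree : nat := \max_(v : vert G) degree v.
Definition cubic : bool := [forall v, degree v == 3].

Definition adj F : rel (vert G) :=
  [rel x y | [exists e in F, ends e == [set x; y]]].
Definition connected F : bool := [forall x, forall y, connect (adj F) x y].
Definition bridgeless : bool :=
  connected setT && [forall e, connected [set~ e]].

(* A cycle is an even subgraph; only its edge set matters below. *)
Definition is_cycle C : bool := [forall v, ~~ odd (degin C v)].

(* A circuit is a connected 2-regular subgraph. *)
Definition is_circuit C : bool :=
  [&& C != set0,
      [forall v, (degin C v == 0) || (degin C v == 2)]
    & [forall x, forall y,
        (0 < degin C x) && (0 < degin C y) ==> connect (adj C) x y]].

Definition spanning_tree F : bool :=
  connected F && [forall C : {set edge G}, (C \subset F) ==> ~~ is_circuit C].

(* Families of cycles may repeat members, hence sequences. *)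
Definition cycle_cover (Cs : seq {set edge G}) : Prop :=
  all is_cycle Cs /\ forall e, has (fun C => e \in C) Cs.
Definition cover_length (Cs : seq {set edge G}) : nat := \sum_(C <- Cs) #|C|.
Definition scc : option nat :=
  minimum (fun n => exists2 Cs, cycle_cover Cs & cover_length Cs = n).

Definition edge_colorable (k : nat) : bool :=
  [exists c : {ffun edge G -> 'I_k}, [forall e, forall f,
     (e != f) && (ends e :&: ends f != set0) ==> (c e != c f)]].

Lemma edge_colorable_ex : exists k, edge_colorable k.
Proof.
exists #|edge G|; apply/existsP; exists [ffun e => enum_rank e].
apply/forallP=> e; apply/forallP=> f; apply/implyP=> /andP[nef _].
by rewrite !ffunE (inj_eq enum_rank_inj).
Qed.

Definition chromatic_index : nat := ex_minn edge_colorable_ex.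
Definition classI : bool := chromatic_index == maxdegree.

Definition perfect_matching M : bool := [forall v, degin M v == 1].

Section AddMatching.
Variables (t : nat) (M : {set edge G}).

Definition add_matching_endp (a : edge G + {e : edge G | e \in M} * 'I_t)
    (b : bool) : vert G :=
  match a with
  | inl e => endp e b
  | inr (e, _) => endp (val e) b
  end.

Lemma add_matching_neq a :
  add_matching_endp a false != add_matching_endp a true.
Proof. by case: a => [e|[e i]]; apply: endp_neq. Qed.

Definition add_matching : mgraph := MGraph add_matching_neq.
End AddMatching.

End Graphs.

Definition l_ (G : mgraph) (M : {set edge G}) : option nat :=
  minimum (fun t => classI (add_matching t M)).

Definition frumious (G : mgraph) : Prop :=
  [/\ bridgeless G, cubic G &
      forall M : {set edge G}, perfect_matching M -> l_ M = None].

Definition snark (G : mgraph) : bool :=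
  [&& bridgeless G, cubic G & chromatic_index G == 4].

Definition isomorphic (G H : mgraph) : Prop :=
  exists (phi : vert G -> vert H) (psi : edge G -> edge H),
    [/\ bijective phi, bijective psi &
        forall e, ends (psi e) = phi @: ends e].

(** * Darts: the dart (e, b) is the edge e traversed from end b to end ~~ b *)

Section Darts.
Variable G : mgraph.

Definition dart : finType := (edge G * bool)%type.
Definition tail (d : dart) : vert G := endp d.1 d.2.
Definition flip (d : dart) : dart := (d.1, ~~ d.2).
Definition head (d : dart) : vert G := tail (flip d).

Lemma flip_inj : injective flip.
Proof. by apply: can_inj (flip) _ => -[e b]; rewrite /flip /= negbK. Qed.

Lemma tail_ends d : tail d \in ends d.1.
Proof. exact: imset_f. Qed.
Lemma head_ends d : head d \in ends d.1.
Proof. exact: imset_f. Qed.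
End Darts.
Arguments tail {G}.
Arguments head {G}.

(** * 4-poles *)

(* Side [false] is left and [true] is right; index [false] is first and
   [true] is second. A dangling edge is the dart that leaves U along it. *)
Record fourpole := FourPole {
  host : mgraph;
  host_cubic : cubic host;
  pset : {set vert host};
  dangling : bool * bool -> dart host;
  dangling_inj : injective dangling;
  danglingP : forall d : dart host,
    ((tail d \in pset) && (head d \notin pset)) = (d \in codom dangling) }.

Section Pole.
Variable A : fourpole.

Definition pvert : finType := {x : vert (host A) | x \in pset A}.
Definition pedge : finType := {e : edge (host A) | ends e \subset pset A}.

Lemma pendp_in (e : pedge) b : endp (val e) b \in pset A.
Proof. by apply: (subsetP (valP e)); apply: imset_f. Qed.

Definition pendp (e : pedge) b : pvert := exist (fun x => x \in pset A) _ (pendp_in e b).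

Lemma pendp_neq e : pendp e false != pendp e true.
Proof. exact: endp_neq. Qed.

Lemma pdang_in (s i : bool) : tail (dangling A (s, i)) \in pset A.
Proof.
by have := danglingP (dangling A (s, i)); rewrite codom_f => /andP[].
Qed.

(* The end-vertex of the i-th dangling edge on side s. *)
Definition pdang (s i : bool) : pvert := exist (fun x => x \in pset A) _ (pdang_in s i).

(* The closure of A: [inr false] and [inr true] are the new vertices u and v;
   [inl (inr (s, i))] joins u (s = false) or v (s = true) to the end-vertex of
   a dangling edge; [inr tt] is the edge uv. *)
Definition closure_endp (e : pedge + bool * bool + unit) (b : bool) :
    pvert + bool :=
  match e with
  | inl (inl e) => inl (pendp e b)
  | inl (inr (s, i)) => if b then inr s else inl (pdang s i)
  | inr _ => inr b
  end.

Lemma closure_neq e : closure_endp e false != closure_endp e true.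
Proof. by case: e => [[e|[s i]]|[]] //=; apply: pendp_neq. Qed.

Definition closure : mgraph := MGraph closure_neq.

Definition frumious_pole : Prop := snark closure /\ frumious closure.
End Pole.

(** * Cubic Halin graphs *)

(* A plane graph is given by its rotation system: [hrot] sends each dart to the
   next one, clockwise, among the darts with the same tail. The faces are the
   orbits of [d |-> hrot (flip d)], which keeps the face on the left of d;
   planarity is Euler's formula. The outer face, selected by [houter], is
   bounded by the circuit K, so that its darts traverse K clockwise. *)
Record halin := Halin {
  hgraph : mgraph;
  hrot : {perm dart hgraph};
  houter : dart hgraph;
  htree : {set edge hgraph};
  hface : {perm dart hgraph} := (perm (@flip_inj hgraph) * hrot)%g;
  outer : {set dart hgraph} := porbit hface houter;
  hcircuit : {set edge hgraph} := ~: htree;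
  leaves : {set vert hgraph} := [set x | degin htree x == 1];
  hrotP : forall d, porbit hrot d = [set d' | tail d' == tail d];
  hplanar : #|vert hgraph| + #|porbits hface| = #|edge hgraph| + 2;
  htree_tree : spanning_tree htree;
  htree_deg2 : forall x, degin htree x != 2;
  hcircuit_circuit : is_circuit hcircuit;
  hcircuit_leaves : forall x, (0 < degin hcircuit x) = (x \in leaves);
  outerP : forall e, #|[set d in outer | d.1 == e]| = (e \in hcircuit);
  (* excludes the one-edge tree, whose leaves span a digon *)
  hleaves_gt2 : 2 < #|leaves| }.

Section Treelike.
Variable H : halin.

Definition odart : finType := {d : dart (hgraph H) | d \in outer H}.
Definition leaf : finType := {x : vert (hgraph H) | x \in leaves H}.
Definition tedge : finType := {e : edge (hgraph H) | e \in htree H}.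

Lemma outer_leaf (d : odart) x : x \in ends (val d).1 -> x \in leaves H.
Proof.
move=> xd; have dK : (val d).1 \in hcircuit H.
  have := outerP (val d).1; case: (_ \in hcircuit H) => // /eqP.
  rewrite cards_eq0 => /eqP/setP/(_ (val d)).
  by rewrite !inE eqxx (valP d).
rewrite -hcircuit_leaves card_gt0; apply/set0Pn; exists (val d).1.
by rewrite inE dK.
Qed.

Definition otail (d : odart) : leaf :=
  exist (fun x => x \in leaves H) _ (outer_leaf (tail_ends (val d))).
Definition ohead (d : odart) : leaf :=
  exist (fun x => x \in leaves H) _ (outer_leaf (head_ends (val d))).

(* The edges of K, oriented clockwise, index the 4-poles. *)
Variable P : odart -> fourpole.

(* Vertices: those of T, the x_i for each leaf x, and those of the 4-poles. *)
Definition tl_vert : finType :=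
  (vert (hgraph H) + leaf * bool + {d : odart & pvert (P d)})%type.

(* Edges: those of T, the x x_i, those of the 4-poles, and the edges obtained
   by joining the dangling edges. *)
Definition tl_edge : finType :=
  (tedge + leaf * bool + {d : odart & pedge (P d)} + odart * (bool * bool))%type.

Definition tl_endp (e : tl_edge) (b : bool) : tl_vert :=
  match e with
  | inl (inl (inl e)) => inl (inl (endp (val e) b))
  | inl (inl (inr (x, i))) =>
      if b then inl (inr (x, i)) else inl (inl (val x))
  | inl (inr (existT d e)) => inr (existT _ d (pendp e b))
  | inr (d, (s, i)) =>
      if b then inl (inr (if s then ohead d else otail d, i))
      else inr (existT _ d (pdang (P d) s i))
  end.

Lemma tl_neq e : tl_endp e false != tl_endp e true.
Proof.
case: e => [[[e|[x i]]|[d e]]|[d [s i]]] //=; first exact: endp_neq.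
apply: contraNneq (pendp_neq e) => /(congr1 (fun w : tl_vert =>
  if w is inr w then w == existT _ d (pendp e true) else false)) /=.
by rewrite eqxx -tag_eqE /tag_eq /= eqxx tagged_asE.
Qed.

Definition treelike_graph : mgraph := MGraph tl_neq.
End Treelike.

Definition treelike_snark (G : mgraph) : Prop :=
  cubic G /\
  exists (H : halin) (P : odart H -> fourpole),
    [/\ cubic (hgraph H), forall d, frumious_pole (P d)
      & isomorphic G (treelike_graph P)].

(* Main.v *)
Require Import Defs.
From mathcomp Require Import all_boot all_order all_algebra.
From mathcomp Require Import fingroup perm boolp zify.

(* If a cubic graph has a cycle cover of length at most 4|E|/3, every vertex is
   met by exactly two cycles of the cover, and the doubly covered edges form a
   perfect matching M; colouring each copy of an edge by a cycle (for edges
   outside M, the one that contains it; for edges of M, those that do not) shows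
   that G + tM is Class I for t = k - 3, where k is the number of cycles. So the
   closures of frumious poles have no such cover.
   In a treelike graph, let S(e) be the set of cycles of a short cover through e
   and give each pole the jump D = S(l1) + S(l2) = S(r1) + S(r2) (sums mod 2).
   If D is nonempty, adding an edge uv labelled D covers the closure unless
   |D| <> 1 and some side of the pole has a doubly covered dangling edge. Around
   a leaf, D changes by the label of the leaf edge, so the labels of the tree
   edges are the differences of a labelling of the inner faces of the Halin
   graph by jumps. No jump is empty: the inner face of its pole is bounded by a
   tree edge in one cycle only, and the face across would have a jump of size 1.
   Some leaf edge is in one cycle only, as otherwise all jumps would have equal
   parity. Counting the sides with two singly covered dangling edges against the
   poles with even jump, by poles and by leaves, gives a contradiction.
   A cycle of the closure of a pole extends through the tree to the treelike
   graph, and each tree edge is on such an extension; so covers exist. *)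

Set Implicit Arguments.
Unset Strict Implicit.
Unset Printing Implicit Defensive.

(** * Parities of edge functions at vertices *)

Section Star.
Variable G : mgraph.
Implicit Types (e : edge G) (v x y r : vert G) (C F T P : {set edge G}).

Lemma in_ends e v : (v \in ends e) = (endp e false == v) || (endp e true == v).
Proof.
apply/imsetP/orP => [[[] _ ->]|[]/eqP<-]; rewrite ?eqxx; auto.
- by exists false.
- by exists true.
Qed.

Lemma big_ends (R : Type) (idx : R) (op : Monoid.com_law idx) v e (x : R) :
  \big[op/idx]_(b | endp e b == v) x = if v \in ends e then x else idx.
Proof.
rewrite big_mkcond big_bool in_ends /=.
case: (_ =P v) => [<-|_]; case: eqP => [E|_] /=; rewrite ?Monoid.mulm1 ?Monoid.mul1m //.
by have := endp_neq e; rewrite E eqxx.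
Qed.

Lemma big_star (R : Type) (idx : R) (op : Monoid.com_law idx) v
    (f : edge G -> R) :
  \big[op/idx]_(e | v \in ends e) f e =
  \big[op/idx]_e \big[op/idx]_(b | endp e b == v) f e.
Proof. by rewrite big_mkcond; apply: eq_bigr => e _; rewrite big_ends. Qed.

(** The boundary of [f] over the two-element field. Summing over edges and their ends, rather than
    over incident edges, lets sums over edges and vertices be exchanged. *)
Definition par (f : edge G -> bool) v : bool :=
  \big[addb/false]_e \big[addb/false]_(b | endp e b == v) f e.

Lemma odd_sum (I : Type) (r : seq I) (p : pred I) (F : I -> nat) :
  odd (\sum_(i <- r | p i) F i) = \big[addb/false]_(i <- r | p i) odd (F i).
Proof. exact: (big_morph odd oddD). Qed.

Lemma degin_sum F v : degin F v = \sum_(e | v \in ends e) (e \in F).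
Proof.
rewrite /degin -sum1_card big_mkcond [RHS]big_mkcond; apply: eq_bigr => e _.
by rewrite !inE; case: (e \in F); case: (v \in ends e).
Qed.

Lemma odd_degin F v : odd (degin F v) = par [in F] v.
Proof. by rewrite degin_sum odd_sum big_star; do 2![apply: eq_bigr => ? _]; rewrite oddb. Qed.

Lemma eq_par f g v : f =1 g -> par f v = par g v.
Proof. by move=> fg; apply: eq_bigr => e _; apply: eq_bigr => b _. Qed.

Lemma par_add f g v : par (fun e => f e (+) g e) v = par f v (+) par g v.
Proof. by rewrite /par -big_split /=; apply: eq_bigr => e _; rewrite big_split. Qed.

Lemma par_edge e v : par (pred1 e) v = (v \in ends e).
Proof.
rewrite /par -big_star big_mkcond (bigD1 e) //= eqxx big1 ?addbF => [|f /negbTE->].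
  by case: (v \in _).
by case: ifP.
Qed.

(** An edge with both ends in [X] cancels, so only the edges leaving [X] remain. *)
Lemma handshake f (X : {set vert G}) :
  \big[addb/false]_(v in X) par f v =
  \big[addb/false]_e (f e && ((endp e false \in X) (+) (endp e true \in X))).
Proof.
rewrite /par exchange_big /=; apply: eq_bigr => e _.
under eq_bigr => v _ do rewrite big_mkcond big_bool /=.
rewrite big_split /= -!big_mkcondr /= andb_addr addbC.
have H b : \big[addb/false]_(v in X | endp e b == v) f e = f e && (endp e b \in X).
  rewrite big_mkcond (bigD1 (endp e b)) //= eqxx andbT big1 ?addbF => [|w].
    by case: ifP; rewrite ?andbT ?andbF.
  by rewrite eq_sym => /negbTE->; rewrite andbF.
by rewrite !H.
Qed.

Lemma handshakeT f : \big[addb/false]_v par f v = false.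
Proof.
have := handshake f setT; under eq_bigl => v do rewrite inE.
by move=> ->; apply: big1 => e _; rewrite !inE andbF.
Qed.

Lemma sum_star (f : edge G -> nat) : \sum_v \sum_(e | v \in ends e) f e = 2 * \sum_e f e.
Proof.
under eq_bigr => v _ do rewrite big_star.
rewrite exchange_big big_distrr /=; apply: eq_bigr => e _.
under eq_bigr => v _ do rewrite big_mkcond big_bool /=.
by rewrite big_split /= -!big_mkcond /= (big_pred1 (endp e true)) ?(big_pred1 (endp e false))
  ?mul2n ?addnn // => v; rewrite eq_sym.
Qed.

(** * Joins, forests and connectivity *)

Definition even_set C := forall v, par [in C] v = false.

Lemma even_cycle C : is_cycle C <-> even_set C.
Proof.
split=> [/forallP ev v|ev]; first by rewrite -odd_degin; apply/negbTE; exact: ev.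
by apply/forallP=> v; rewrite odd_degin ev.
Qed.

Definition symdiff (C F : {set edge G}) := [set e | (e \in C) (+) (e \in F)].

Lemma par_symdiff C F v : par [in symdiff C F] v = par [in C] v (+) par [in F] v.
Proof. by rewrite -par_add; apply: eq_par => e; rewrite inE. Qed.

Lemma symdiff_sub C F T : C \subset T -> F \subset T -> symdiff C F \subset T.
Proof.
move=> /subsetP sC /subsetP sF; apply/subsetP=> e; rewrite inE.
by case: (boolP (e \in C)) => [/sC->|_ /sF].
Qed.

Lemma par_set0 v : par [in set0] v = false.
Proof. by apply: big1 => e _; apply: big1 => b _; rewrite /= inE. Qed.

Lemma endsE e b : ends e = [set endp e b; endp e (~~ b)].
Proof.
by apply/setP=> v; rewrite in_ends !inE ![v == _]eq_sym; case: b => //; rewrite orbC.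
Qed.

Lemma adjP F x y :
  reflect (exists2 e, e \in F & exists b, endp e b = x /\ endp e (~~ b) = y)
          (adj F x y).
Proof.
apply: (iffP exists_inP) => [[e eF /eqP E]|[e eF [b [<- <-]]]]; last first.
  by exists e; rewrite // (endsE e b).
exists e => //.
have /imsetP[b _ xE] : x \in ends e by rewrite E !inE eqxx.
have /imsetP[c _ yE] : y \in ends e by rewrite E !inE eqxx orbT.
have /eqP : #|ends e| = 2 by rewrite (endsE e false) cards2 endp_neq.
exists b; split=> //; rewrite yE; have := E; rewrite xE yE.
case: (b =P c) => [<-|]; last by case: b c {xE yE} => -[].
by move=> /(congr1 (fun A : {set _} => #|A|)); rewrite (endsE e false) !cards2 endp_neq eqxx.
Qed.

Lemma adj_sym F : symmetric (adj F).
Proof. by move=> x y; apply: eq_existsb => e; rewrite setUC. Qed.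

(** [P] is the mod 2 sum of the edges of a walk; repeated edges cancel and the boundary is that of
    the walk. *)
Lemma join F x y : connect (adj F) x y ->
  exists2 P : {set edge G}, P \subset F &
    forall v, par [in P] v = (x == v) (+) (y == v).
Proof.
move=> /connectP[p]; elim: p x => [|z p IH] x /=.
  by move=> _ ->; exists set0; [apply: sub0set | move=> v; rewrite par_set0 addbb].
case/andP => xz pz yE; have [P PF Pv] := IH _ pz yE.
have [e eF [b [xE zE]]] := adjP _ _ _ xz.
exists (symdiff P [set e]); first by rewrite symdiff_sub ?sub1set.
move=> v; rewrite par_symdiff Pv (@eq_par [in [set e]] (pred1 e)) => [|f]; last by rewrite /= inE.
rewrite par_edge (endsE e b) !inE ![v == _]eq_sym -xE -zE.
have: endp e b != endp e (~~ b) by have := endp_neq e; case: b {xE zE}; rewrite // eq_sym.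
case: (endp e b =P v) => [->|_] /=; case: (endp e (~~ b) =P v) => [->|_];
  by rewrite ?eqxx //; case: (y == v).
Qed.

(** Acyclicity in linear form: the boundary map has trivial kernel on the subsets of [T]. *)
Definition forest T := forall C, C \subset T -> even_set C -> C = set0.

Lemma par0_out C (A : {set vert G}) v :
  (forall e, e \in C -> ends e \subset A) -> v \notin A -> par [in C] v = false.
Proof.
move=> CA vA; apply: big1 => e _; apply: big1 => b /eqP ev /=.
by apply: contraNF vA => /CA/subsetP; apply; rewrite -ev imset_f.
Qed.

Lemma even_from_root C r : (forall v, v != r -> par [in C] v = false) -> even_set C.
Proof.
move=> Cv v; case: (eqVneq v r) => [->|/Cv//].
by have := handshakeT [in C]; rewrite (bigD1 r) //= big1 ?addbF // => w /Cv.
Qed.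

(* Counting over F_2: the boundary map is injective on the edge subsets of a
   forest, and its image, missing one vertex, lies in the subsets of A :\ r. *)
Lemma forest_card T (A : {set vert G}) : forest T -> A != set0 ->
  #|[set e in T | ends e \subset A]| < #|A|.
Proof.
move=> fT /set0Pn[r rA]; set F := [set e in T | _].
have FA C e : C \subset F -> e \in C -> ends e \subset A.
  by move=> /subsetP CF /CF; rewrite inE => /andP[].
rewrite (cardsD1 r A) rA add1n ltnS -(leq_exp2l _ _ (ltnSn 1)) -!card_powerset.
pose bd C := [set v in A :\ r | par [in C] v].
rewrite -(@card_in_imset _ _ bd (mem (powerset F))).
  apply: subset_leq_card; apply/subsetP => _ /imsetP[C _ ->].
  by rewrite inE; apply/subsetP=> v; rewrite inE => /andP[].
move=> C C'; rewrite !inE => CF CF' /setP E.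
have S0 : symdiff C C' = set0.
  apply: fT.
    by apply: subset_trans (symdiff_sub CF CF') _; apply/subsetP=> e; rewrite inE => /andP[].
  apply: (@even_from_root _ r) => v vr; rewrite par_symdiff.
  have := E v; rewrite !inE vr /=; case: (boolP (v \in A)) => /= [_ ->|vA _]; first by rewrite addbb.
  by rewrite !(@par0_out _ A) // => e; apply: FA.
apply/setP=> e; have /setP/(_ e) := S0; rewrite !inE.
by case: (e \in C); case: (e \in C').
Qed.

(** Otherwise the edges of [T] inside [A] have degree sum at least 2|[A]|, against [forest_card]. *)
Lemma forest_low T (A : {set vert G}) : forest T -> A != set0 ->
  exists2 v, v \in A & #|[set e in T | (v \in ends e) && (ends e \subset A)]| <= 1.
Proof.
move=> fT A0; apply/exists_inP; apply: contraT; rewrite negb_exists_in => /forall_inP H.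
have := forest_card fT A0; set F := [set e in T | _] => /ltn_geF/negP[].
rewrite -(leq_pmul2l (isT : 0 < 2)) -[#|F|]sum1_card big_mkcond -sum_star.
apply: (@leq_trans (\sum_(v in A) \sum_(e | v \in ends e) (e \in F))).
  rewrite mulnC -sum_nat_const; apply: leq_sum => v /H; rewrite -ltnNge => /leq_trans-> //.
  rewrite -degin_sum; apply: subset_leq_card; apply/subsetP=> e; rewrite !inE.
  by case/and3P=> -> -> ->.
by rewrite big_mkcond; apply: leq_sum => v _; case: ifP.
Qed.

(** The counterpart of [forest_card]: joins to the root [r] show that the boundary map is onto the
    subsets of [[set~ r]]. *)
Lemma connected_card T : connected T -> #|vert G| <= #|T|.+1.
Proof.
move=> cT; case: (posnP #|vert G|) => [->//|/card_gt0P[r _]].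
have D : #|vert G| = #|[set~ r]|.+1 by rewrite -cardsT (cardsD1 r) inE setTD.
rewrite D ltnS -(leq_exp2l _ _ (ltnSn 1)) -!card_powerset.
pose bd C := [set v in [set~ r] | par [in C] v].
apply: leq_trans (leq_imset_card bd _); apply: subset_leq_card.
apply/subsetP => X; rewrite inE => Xr.
suff [C CT Cv] : exists2 C : {set edge G}, C \subset T & forall v, v != r -> par [in C] v = (v \in X).
  apply/imsetP; exists C; rewrite ?inE //; apply/setP=> v; rewrite !inE.
  case: (eqVneq v r) => [->|/Cv//]; apply/negbTE.
  by apply: contraL (eqxx r) => /(subsetP Xr); rewrite !inE.
move: {2}#|X|.+1 (ltnSn #|X|) => n; elim: n X {Xr} => // n IH X Xn.
have [->|[x xX]] := set_0Vmem X.
  by exists set0; rewrite ?sub0set // => v _; rewrite par_set0 inE.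
have [|C CT Cv] := IH (X :\ x); first by rewrite (cardsD1 x) xX in Xn.
have [P PT Pv] := join (forallP (forallP cT r) x).
exists (symdiff C P); rewrite ?symdiff_sub // => v vr.
rewrite par_symdiff Cv // Pv (eq_sym r) (negbTE vr) !inE (eq_sym x).
by case: eqVneq => [->|_] /=; rewrite ?xX ?addbF.
Qed.

End Star.

(** * Cubic graphs and tight labellings *)

Section Cubic.
Variable G : mgraph.
Implicit Types (e f g : edge G) (v x y : vert G) (C F T M : {set edge G}).

Lemma sum_cubic v : cubic G -> \sum_(e | v \in ends e) 1 = 3.
Proof.
move=> /forallP/(_ v)/eqP; rewrite /degree degin_sum => <-.
by apply: eq_bigr => e _; rewrite inE.
Qed.

Lemma edges_cubic : cubic G -> 2 * #|edge G| = 3 * #|vert G|.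
Proof.
move=> cG; rewrite -[#|edge G|]sum1_card -sum_star.
by under eq_bigr => v _ do rewrite sum_cubic //; rewrite sum_nat_const mulnC.
Qed.

(** A smallest nonempty even subset of [T] would be a circuit: in a cubic graph its degrees can only
    be 0 and 2. *)
Lemma spanning_forest T : cubic G -> spanning_tree T -> forest T.
Proof.
move=> cG /andP[_ /forallP noC] C0 C0T /even_cycle ev0.
apply/eqP; apply: contraT => C0n.
pose p C := [&& C \subset T, is_cycle C & C != set0].
have p0 : p C0 by rewrite /p C0T ev0.
case: (arg_minnP (fun C : {set edge G} => #|C|) p0) => C /and3P[CT Cc Cn] Cmin.
have /negP := implyP (noC C) CT; case; rewrite /is_circuit Cn /=; apply/andP; split.
  apply/forallP=> v; have := forallP Cc v.
  have : degin C v <= 3.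
    by rewrite -(sum_cubic v cG) degin_sum; apply: leq_sum => e _; case: (_ \in _).
  by case: (degin C v) => [|[|[|[|]]]].
apply/forallP=> x; apply/forallP=> y; apply/implyP=> /andP[x0 y0].
(* The component of [C] at [x] is even and nonempty, so by minimality it is all of [C]. *)
pose K := [set e in C | connect (adj C) x (endp e false)].
have Cconn e b : e \in C ->
    connect (adj C) x (endp e b) = connect (adj C) x (endp e false).
  move=> eC; case: b => //; apply/idP/idP => /connect_trans; apply; apply: connect1; apply/adjP.
    by exists e => //; exists true.
  by exists e => //; exists false.
have endC v e : v \in ends e -> e \in C -> (e \in K) = connect (adj C) x v.
  move=> ve eC; rewrite inE eC /=.
  by move: ve; rewrite in_ends => /orP[]/eqP<-; rewrite ?Cconn.
have xK v : connect (adj C) x v -> degin K v = degin C v.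
  move=> xv; rewrite !degin_sum; apply: eq_bigr => e ve.
  by case eC: (e \in C); [rewrite (endC v) ?xv | rewrite inE eC].
have KE : K = C.
  apply/eqP; rewrite eqEcard; apply/andP; split.
    by apply/subsetP=> e; rewrite inE => /andP[].
  apply: Cmin; apply/and3P; split.
  - by apply: subset_trans CT; apply/subsetP=> e; rewrite inE => /andP[].
  - apply/forallP=> v; case xv: (connect (adj C) x v); first by rewrite xK ?(forallP Cc).
    rewrite degin_sum big1 // => e ve; case eC: (e \in C); last by rewrite inE eC.
    by rewrite (endC v) ?xv.
  - by apply: contraTneq x0 => K0; rewrite -xK // K0 degin_sum big1 // => e; rewrite inE.
move: y0; rewrite card_gt0 => /set0Pn[e]; rewrite inE -{1}KE => /andP[eK ye].
by rewrite -(endC y e) //; move: eK; rewrite inE => /andP[].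
Qed.

(** A join of the ends of [e] that avoids [e] is closed up by [e]. *)
Lemma bridgeless_cycle e : connected [set~ e] -> exists2 C, even_set C & e \in C.
Proof.
move=> /forallP/(_ (endp e false))/forallP/(_ (endp e true))/join[P Pe Pv].
exists (symdiff P [set e]).
  move=> v; rewrite par_symdiff Pv (@eq_par _ [in [set e]] (pred1 e)); last by move=> f; rewrite /= inE.
  rewrite par_edge in_ends; have := endp_neq e.
  case: (endp e false =P v) => [->|_]; case: (endp e true =P v) => [->|_] //=.
  by rewrite eqxx.
rewrite !inE eqxx addbT; apply/negP => /(subsetP Pe).
by rewrite !inE eqxx.
Qed.

Lemma star_third v e f : cubic G -> e != f -> v \in ends e -> v \in ends f ->
  exists g, uniq [:: e; f; g] /\ forall h, (v \in ends h) = (h \in [:: e; f; g]).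
Proof.
move=> cG ef ve vf.
have /eqP : #|[set h | v \in ends h] :\ e :\ f| = 1.
  have := sum_cubic v cG; rewrite sum1dep_card.
  rewrite (cardsD1 e) !inE ve (cardsD1 f) !inE eq_sym ef vf /=.
  by rewrite !add1n => -[].
case/cards1P => g gE; exists g; have : g \in [set g] by rewrite inE.
rewrite -gE !inE => /and3P[gf ge _]; split.
  by rewrite /= !inE negb_or ef ![_ == g]eq_sym gf ge.
move=> h; have /setP/(_ h) := gE; rewrite !inE.
by case: eqVneq => [->//|_]; case: eqVneq => [->//|_]; rewrite ?orbT ?orbF.
Qed.

Lemma big_third (R : Type) (idx : R) (op : Monoid.com_law idx) v e f g (F : edge G -> R) :
  uniq [:: e; f; g] -> (forall h, (v \in ends h) = (h \in [:: e; f; g])) ->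
  \big[op/idx]_(h | v \in ends h) F h = op (F e) (op (F f) (F g)).
Proof.
move=> u E; rewrite (eq_bigl _ _ E) -big_uniq //.
by rewrite !big_cons big_nil Monoid.mulm1.
Qed.

End Cubic.

(* The labels of an edge are the cycles of a cover that contain it; the cover
   has length 4|E|/3 exactly when each vertex is met by two of its cycles. *)
Definition tight (G : mgraph) (L : finType) (S : edge G -> {set L}) :=
  [/\ forall e, S e != set0,
      forall v, \sum_(e | v \in ends e) #|S e| = 4
    & forall i v, par (fun e => i \in S e) v = false].

Definition palette (L : finType) (X : {set L}) := if #|X| == 2 then ~: X else X.

(* X, Y, Z are the labels of the edges at a vertex; the copies of a doubly
   covered edge are coloured by the labels missing from it. *)
Lemma palette_disjoint (L : finType) (X Y Z : {set L}) :
  X != set0 -> Y != set0 -> Z != set0 -> #|X| + (#|Y| + #|Z|) = 4 ->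
  (forall i, (i \in X) (+) ((i \in Y) (+) (i \in Z)) = false) ->
  [disjoint palette X & palette Y].
Proof.
rewrite -!card_gt0 => X0 Y0 Z0 s4 XYZ.
have [[X1 [Y1 Z2]]|[[X1 [Y2 Z1]]|[X2 [Y1 Z1]]]] : (#|X| = 1 /\ #|Y| = 1 /\ #|Z| = 2) \/
    (#|X| = 1 /\ #|Y| = 2 /\ #|Z| = 1) \/ (#|X| = 2 /\ #|Y| = 1 /\ #|Z| = 1) by lia.
(* Equal singletons [X] and [Y] would cancel and leave [Z] empty. *)
- rewrite /palette X1 Y1 /=; apply/pred0P => i /=; apply/negbTE/negP => /andP[iX iY].
  have /cards1P[j Xj] : #|X| == 1 by rewrite X1.
  have /cards1P[l Yl] : #|Y| == 1 by rewrite Y1.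
  move: iX iY; rewrite Xj Yl !inE => /eqP ij /eqP il.
  have /card_gt0P[m mZ] := Z0; have := XYZ m.
  by rewrite mZ Xj Yl -ij -il addbT addbN addbb.
(* If the label of [X] were missing from [Y], parity would give [X] = [Z], and [Y] would be
   empty. *)
- rewrite /palette X1 Y2 /= -subsets_disjoint; apply/subsetP=> i iX.
  apply: contraT => iY; have := XYZ i; rewrite iX (negbTE iY) /= => /negbFE iZ.
  have /cards1P[j Xj] : #|X| == 1 by rewrite X1.
  have /cards1P[l Zl] : #|Z| == 1 by rewrite Z1.
  have /card_gt0P[m mY] := Y0; have := XYZ m; rewrite mY.
  move: iX iZ; rewrite Xj Zl !inE => /eqP<- /eqP<-.
  by rewrite addTb addbN addbb.
- rewrite /palette X2 Y1 /= disjoint_sym -subsets_disjoint; apply/subsetP=> i iY.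
  apply: contraT => iX; have := XYZ i; rewrite iY (negbTE iX) /= => /negbFE iZ.
  have /cards1P[j Yj] : #|Y| == 1 by rewrite Y1.
  have /cards1P[l Zl] : #|Z| == 1 by rewrite Z1.
  have /card_gt0P[m mX] := X0; have := XYZ m; rewrite mX.
  move: iY iZ; rewrite Yj Zl !inE => /eqP<- /eqP<-.
  by rewrite addbb.
Qed.

Lemma maxdegree_chromatic (G : mgraph) : maxdegree G <= chromatic_index G.
Proof.
rewrite /chromatic_index; case: ex_minnP => k /existsP[c /forallP cP] _.
apply/bigmax_leqP => v _; rewrite -[X in _ <= X]card_ord.
have ci : {in [set e in setT | v \in ends e] &, injective c}.
  move=> e f; rewrite !inE /= => ve vf cef; apply/eqP; apply: contraT => ef.
  have := implyP (forallP (cP e) f); rewrite ef cef eqxx /= => -> //.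
  by apply/set0Pn; exists v; rewrite inE ve.
by rewrite /degree /degin -(card_in_imset ci) max_card.
Qed.

Section Tight.
Variables (G : mgraph) (L : finType) (S : edge G -> {set L}).
Hypotheses (cG : cubic G) (tS : tight S).
Implicit Types (e f g : edge G) (v : vert G).

Lemma tight_pos e : 0 < #|S e|.
Proof. by rewrite card_gt0; case: tS. Qed.

Lemma tight_third v e f : e != f -> v \in ends e -> v \in ends f ->
  exists g, [/\ uniq [:: e; f; g], forall h, (v \in ends h) = (h \in [:: e; f; g]),
    #|S e| + (#|S f| + #|S g|) = 4 &
    forall i, (i \in S e) (+) ((i \in S f) (+) (i \in S g)) = false].
Proof.
move=> ef ve vf; have [g [u E]] := star_third cG ef ve vf; exists g.
case: tS => _ s4 p; split=> // [|i].
  by rewrite -(s4 v) (big_third _ _ u E).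
by rewrite -(p i v) /par -big_star (big_third _ _ u E).
Qed.

Lemma tight_le2 e : #|S e| <= 2.
Proof.
have ve : endp e false \in ends e by rewrite imset_f.
have : 2 <= #|[set h | endp e false \in ends h] :\ e|.
  have := sum_cubic (endp e false) cG; rewrite sum1dep_card.
  by rewrite (cardsD1 e) !inE ve add1n => -[->].
move=> /(leq_trans (isT : 0 < 2))/card_gt0P[f]; rewrite !inE eq_sym => /andP[ef vf].
have [g [_ _ s4 _]] := tight_third ef ve vf.
by have := tight_pos f; have := tight_pos g; lia.
Qed.

Definition doubled := [set e | #|S e| == 2].

(** Each of the three edges at a vertex has one or two labels, and four in all means that exactly
    one has two. *)
Lemma doubled_perfect : perfect_matching doubled.
Proof.
case: tS => _ s4 _; apply/forallP=> v; apply/eqP/(@addnI 3); rewrite -[RHS](s4 v).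
rewrite degin_sum -{1}(sum_cubic v cG) -big_split /=; apply: eq_bigr => e _; rewrite inE.
by have := tight_pos e; have := tight_le2 e; case: #|S e| => [|[|[|]]].
Qed.

End Tight.

(** * Class I colourings from tight labellings *)

Section Colouring.
Variables (G : mgraph) (k : nat) (S : edge G -> {set 'I_k}) (v0 : vert G).
Hypotheses (cG : cubic G) (tS : tight S) (k3 : 3 <= k).
(** A doubled edge misses k - 2 labels, exactly enough for itself and its [t] added copies. *)
Let t := k - 3.
Let GM := add_matching t (doubled S).

Let base (a : edge GM) : edge G := match a with inl e => e | inr (e, _) => val e end.
(** A position in the palette: the added copies of a doubled edge take 0 to t - 1 and the edge
    itself takes [t]. *)
Let copy (a : edge GM) : nat :=
  match a with inl e => if e \in doubled S then t else 0 | inr (_, i) => i end.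

Lemma copy_lt a : copy a < #|palette (S (base a))|.
Proof.
case: a => [e|[[e eM] i]] /=; rewrite /palette; last first.
  have := eM; rewrite inE => eM'; rewrite eM' cardsCs setCK card_ord (eqP eM').
  by have := ltn_ord i; rewrite /t; lia.
rewrite inE; case: ifP => eM; last exact: tight_pos.
by rewrite cardsCs setCK card_ord (eqP eM) /t; lia.
Qed.

Lemma base_copy_inj a b : base a = base b -> copy a = copy b -> a = b.
Proof.
case: a => [e|[[e eM] i]]; case: b => [f|[[f fM] j]] //= E.
- by rewrite E.
- by rewrite E fM => tj; have := ltn_ord j; rewrite -tj ltnn.
- by rewrite -E eM => it; have := ltn_ord i; rewrite it ltnn.
- move=> /val_inj ->; congr (inr (_, _)); exact: val_inj.
Qed.

Lemma tight_classI : classI GM.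
Proof.
have i0 : 'I_k by exists 0; apply: leq_trans k3.
(* The palettes give a colouring with [k] colours, and [v0] has degree 3 + t = k. *)
apply/eqP/anti_leq; rewrite maxdegree_chromatic andbT; apply: (@leq_trans k).
  rewrite /chromatic_index; case: ex_minnP => m _; apply.
  apply/existsP; exists [ffun a => nth i0 (enum (palette (S (base a)))) (copy a)].
  apply/forallP=> a; apply/forallP=> b; apply/implyP=> /andP[ab /set0Pn[v]].
  have endsb c : ends c = ends (base c).
    by case: c => [e|[[e eM] i]]; apply/setP=> w; rewrite !in_ends.
  rewrite inE !endsb => /andP[va vb]; rewrite !ffunE.
  have sa := copy_lt a; have sb := copy_lt b; rewrite !cardE in sa sb.
  have [E|ne] := eqVneq (base a) (base b).
    rewrite -E in sb *; rewrite nth_uniq ?enum_uniq //.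
    by apply: contra ab => /eqP /(base_copy_inj E) ->.
  have [g [_ _ s4 p]] := tight_third cG tS ne va vb.
  have n0 e : S e != set0 by case: tS.
  have d := palette_disjoint (n0 _) (n0 _) (n0 _) s4 p.
  have aP : nth i0 (enum (palette (S (base a)))) (copy a) \in palette (S (base a)).
    by rewrite -mem_enum mem_nth.
  apply: contraTneq aP => ->.
  by rewrite (disjointFl d) // -mem_enum mem_nth.
apply: leq_trans (leq_bigmax v0); rewrite /degree degin_sum big_mkcond.
rewrite big_sumType /=.
have -> : \sum_e (if v0 \in @ends GM (inl e) then (inl e \in [set: edge GM]) : nat else 0) = 3.
  rewrite -(sum_cubic v0 cG) [RHS]big_mkcond; apply: eq_bigr => e _.
  by rewrite !inE !in_ends.
rewrite -leq_subLR -/t.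
have /forallP/(_ v0)/cards1P[e /setP/(_ e)] := doubled_perfect cG tS.
rewrite !inE eqxx => /andP[eM ve].
have eM' : e \in doubled S by rewrite inE.
rewrite -[X in X <= _]card_ord -sum1_card.
pose h (i : 'I_t) : {e | e \in doubled S} * 'I_t := (exist (fun e => e \in doubled S) e eM', i).
have hi : injective h by move=> i j [].
rewrite -(big_imset (fun=> 1) (in2W hi)) /= big_mkcond /=.
apply: leq_sum => a _; case: imsetP => // -[i _ ->].
by rewrite inE; have := ve; rewrite !in_ends /= => ->.
Qed.
End Colouring.

(** * Tight labellings and short covers *)

Lemma minimumP (P : nat -> Prop) n : minimum P = Some n ->
  P n /\ forall m, P m -> n <= m.
Proof.
rewrite /minimum; case: pselect => // exP [<-].
by case: ex_minnP => m /asboolP Pm mmin; split=> // l Pl; apply/mmin/asboolP.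
Qed.

Lemma minimum_ex (P : nat -> Prop) n : P n -> exists m, minimum P = Some m.
Proof.
rewrite /minimum => Pn; case: pselect => [exP|[]]; first by eexists.
by exists n; apply/asboolP.
Qed.

Lemma frumious_not_tight (G : mgraph) k (S : edge G -> {set 'I_k}) (v0 : vert G) :
  frumious G -> 3 <= k -> ~ tight S.
Proof.
move=> [_ cG frG] k3 tS.
have := frG _ (doubled_perfect cG tS); rewrite /l_.
have [m] := minimum_ex (P := fun t => classI (add_matching t (doubled S)))
  (tight_classI v0 cG tS k3).
by move=> ->.
Qed.

(** The label sum at a vertex is even and at least 3, hence at least 4. The length bound makes the
    total over all vertices at most 4|V|, so every sum is 4. *)
Lemma short_cover_tight (G : mgraph) (Cs : seq {set edge G}) :
  cubic G -> cycle_cover Cs -> 3 * cover_length Cs <= 4 * #|edge G| ->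
  exists k (S : edge G -> {set 'I_k}), 3 <= k /\ tight S.
Proof.
move=> cG [/allP cyc cov] short.
(* Three empty cycles add no length and ensure that [k] is at least 3. *)
pose Ds := Cs ++ nseq 3 set0.
have lenD : cover_length Ds = cover_length Cs.
  by rewrite /cover_length big_cat /= !big_cons big_nil !cards0 !addn0.
pose S e := [set i : 'I_(size Ds) | e \in nth set0 Ds i].
have cycD (i : 'I_(size Ds)) : is_cycle (nth set0 Ds i).
  have := mem_nth set0 (ltn_ord i); rewrite mem_cat => /orP[/cyc//|].
  by rewrite mem_nseq /= => /eqP->; apply/even_cycle=> v; rewrite par_set0.
exists (size Ds), S; split; first by rewrite size_cat /= leq_addl.
have S0 e : S e != set0.
  have /hasP[C CC eC] := cov e; apply/set0Pn.
  have iC : index C Ds < size Ds by rewrite index_mem mem_cat CC.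
  by exists (Ordinal iC); rewrite inE /= nth_index // mem_cat CC.
have Spar i v : par (fun e => i \in S e) v = false.
  have /even_cycle/(_ v) <- := cycD i.
  by apply: eq_par => e; rewrite inE.
have sumS (P : pred (edge G)) : \sum_(e | P e) #|S e| =
    \sum_(i < size Ds) \sum_(e | P e) (i \in S e).
  rewrite exchange_big; apply: eq_bigr => e _.
  by rewrite -sum1_card big_mkcond; apply: eq_bigr => i _; case: ifP.
have ge4 v : 4 <= \sum_(e | v \in ends e) #|S e|.
  have ev : odd (\sum_(e | v \in ends e) #|S e|) = false.
    rewrite sumS odd_sum big1 // => i _; rewrite odd_sum.
    rewrite big_star -[RHS](Spar i v).
    by do 2![apply: eq_bigr => ? _]; rewrite oddb.
  have : 3 <= \sum_(e | v \in ends e) #|S e|.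
    by rewrite -(sum_cubic v cG); apply: leq_sum => e _; rewrite card_gt0.
  by case: (\sum_(e | _) _) ev => [|[|[|[|]]]].
have tot : \sum_e #|S e| = cover_length Ds.
  rewrite sumS /cover_length (big_nth set0) big_mkord; apply: eq_bigr => i _.
  by rewrite -sum1_card [RHS]big_mkcond; apply: eq_bigr => e _; rewrite inE; case: ifP.
split=> // v; apply/eqP; rewrite eqn_leq ge4 andbT.
have : \sum_w \sum_(e | w \in ends e) #|S e| <= \sum_(w : vert G) 4.
  have -> : \sum_(w : vert G) 4 = 4 * #|vert G| by rewrite sum_nat_const mulnC.
  rewrite sum_star tot lenD.
  by have := edges_cubic cG; lia.
rewrite (bigD1 v) //= [X in _ <= X](bigD1 v) //=.
rewrite -[in X in _ -> X](leq_add2r (\sum_(w | w != v) 4)).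
by apply: leq_trans; rewrite leq_add2l; apply: leq_sum.
Qed.

Lemma cover_of_cycles (G : mgraph) :
  (forall e : edge G, exists2 C, even_set C & e \in C) ->
  exists Cs : seq {set edge G}, cycle_cover Cs.
Proof.
move=> cyc; exists (enum [pred C : {set edge G} | is_cycle C]); split.
  by apply/allP=> C; rewrite mem_enum.
move=> e; have [C Ce eC] := cyc e; apply/hasP; exists C => //.
by rewrite mem_enum inE; apply/even_cycle.
Qed.

(** * Isomorphisms *)

Lemma isomorphic_sym (G H : mgraph) : isomorphic G H -> isomorphic H G.
Proof.
move=> [phi [psi [[phi' phiK phi'K] [psi' psiK psi'K] E]]].
exists phi', psi'; split; [by exists phi | by exists psi|] => e.
by rewrite -{2}(psi'K e) E -imset_comp (eq_imset _ phiK) imset_id.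
Qed.

Lemma isomorphic_degin (G H : mgraph) (phi : vert G -> vert H) (psi : edge G -> edge H)
    (C : {set edge G}) v : bijective phi -> bijective psi ->
  (forall e, ends (psi e) = phi @: ends e) ->
  degin (psi @: C) (phi v) = degin C v.
Proof.
move=> bphi bpsi E; rewrite !degin_sum big_mkcond (reindex psi) /=; last exact: onW_bij.
rewrite [RHS]big_mkcond; apply: eq_bigr => e _.
by rewrite E !mem_imset //; apply: bij_inj.
Qed.

Lemma isomorphic_cubic (G H : mgraph) : isomorphic G H -> cubic G -> cubic H.
Proof.
move=> [phi [psi [bphi bpsi E]]] /forallP cG; apply/forallP=> w.
have [phi' _ phi'K] := bphi; have [psi' _ psi'K] := bpsi.
rewrite /degree -(phi'K w) (_ : setT = psi @: setT); first by rewrite isomorphic_degin //; apply: cG.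
by apply/setP=> e; rewrite inE -(psi'K e) mem_imset ?inE //; apply: bij_inj.
Qed.

Lemma isomorphic_cover (G H : mgraph) (Cs : seq {set edge G}) :
  isomorphic G H -> cycle_cover Cs ->
  exists2 Ds : seq {set edge H}, cycle_cover Ds & cover_length Ds = cover_length Cs.
Proof.
move=> [phi [psi [bphi bpsi E]]] [/allP cyc cov].
have [phi' _ phi'K] := bphi; have [psi' _ psi'K] := bpsi.
exists [seq psi @: C | C : {set edge G} <- Cs]; last first.
  by rewrite /cover_length big_map; apply: eq_bigr => C _; rewrite card_imset //; apply: bij_inj.
split.
  apply/allP=> _ /mapP[C CC ->]; apply/forallP=> w.
  by rewrite -(phi'K w) isomorphic_degin //; apply/forallP: (phi' w); apply: cyc.
move=> e; have /hasP[C CC eC] := cov (psi' e); apply/hasP; exists (psi @: C).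
  exact: map_f.
by rewrite -(psi'K e) mem_imset //; apply: bij_inj.
Qed.

Lemma isomorphic_edges (G H : mgraph) : isomorphic G H -> #|edge G| = #|edge H|.
Proof. by move=> [_ [psi [_ bpsi _]]]; apply: bij_eq_card bpsi. Qed.

(** * Sums over the edges at a vertex of a closure or a treelike graph *)

Lemma big_pairE (R : Type) (idx : R) (op : Monoid.com_law idx) (I J : finType)
    (F : I * J -> R) :
  \big[op/idx]_p F p = \big[op/idx]_i \big[op/idx]_j F (i, j).
Proof. by rewrite pair_bigA; apply: eq_bigr => -[]. Qed.

Lemma big_sigmaE (R : Type) (idx : R) (op : Monoid.com_law idx) (I : finType)
    (J : I -> finType) (F : {i : I & J i} -> R) :
  \big[op/idx]_p F p = \big[op/idx]_i \big[op/idx]_(j : J i) F (existT _ i j).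
Proof.
rewrite (sig_big_dep xpredT (fun _ _ => true) (fun i j => F (existT _ i j))).
by apply: eq_bigr => -[].
Qed.

Lemma big_notin (R : Type) (idx : R) (op : Monoid.com_law idx) (I : finType)
    (p : I -> pred bool) (F : I -> R) :
  (forall i b, p i b = false) -> \big[op/idx]_i \big[op/idx]_(b | p i b) F i = idx.
Proof. by move=> p0; rewrite big1 // => i _; rewrite big_pred0. Qed.

Lemma big_fiber (R : Type) (idx : R) (op : Monoid.com_law idx) (I J : finType)
    (g : I -> J) (F : I -> R) :
  \big[op/idx]_j \big[op/idx]_(i | g i == j) F i = \big[op/idx]_i F i.
Proof. by rewrite [RHS](partition_big g xpredT). Qed.

Lemma big_bool_cond (R : Type) (idx : R) (op : Monoid.com_law idx) (p : pred bool)
    (F : bool -> R) :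
  \big[op/idx]_(b | p b) F b =
  op (if p true then F true else idx) (if p false then F false else idx).
Proof. by rewrite big_mkcond big_bool. Qed.

Section Stars.
Variables (R : Type) (idx : R) (op : Monoid.com_law idx).

Section ClosureStars.
Variables (A : fourpole) (f : edge (Defs.closure A) -> R).

(** This has the same shape as [star_pole], so conditions at the vertices of a pole pass between its
    closure and the treelike graph. *)
Lemma star_closure_pole (w : pvert A) :
  \big[op/idx]_(e | (inl w : vert (Defs.closure A)) \in ends e) f e =
  op (\big[op/idx]_(e : pedge A) \big[op/idx]_(b | pendp e b == w) f (inl (inl e)))
     (\big[op/idx]_s \big[op/idx]_(i | pdang A s i == w) f (inl (inr (s, i)))).
Proof.
rewrite big_star !big_sumType /= [X in op _ X](_ : _ = idx) ?Monoid.mulm1; last first.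
  by apply: big_notin => -[].
congr (op _ _).
rewrite big_pairE; apply: eq_bigr => s _; rewrite [RHS]big_mkcond.
by apply: eq_bigr => i _; rewrite big_mkcond big_bool /= Monoid.mul1m.
Qed.

Lemma star_closure_end s :
  \big[op/idx]_(e | (inr s : vert (Defs.closure A)) \in ends e) f e =
  op (op (f (inl (inr (s, false)))) (f (inl (inr (s, true))))) (f (inr tt)).
Proof.
rewrite big_star !big_sumType /= big_notin // Monoid.mul1m; congr (op _ _).
  rewrite big_pairE (bigD1 s) //= [X in op _ X]big1 => [|s' s's].
    rewrite Monoid.mulm1 big_bool !big_bool_cond /= eqxx.
    by rewrite !Monoid.mulm1 Monoid.mulmC.
  rewrite big1 // => i _; rewrite big_mkcond big_bool /= Monoid.mulm1.
  by rewrite (inj_eq (@inr_inj _ _)) (negbTE s's).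
by rewrite (big_pred1 tt) => [|[]//]; rewrite (big_pred1 s).
Qed.
End ClosureStars.

Section TreelikeStars.
Variables (H : halin) (P : odart H -> fourpole).
Local Notation G := (treelike_graph P).
Variable (f : edge G -> R).

(** A pair [(d, s)] stands for side [s] of the pole [d]. *)
Definition pole_leaf (p : odart H * bool) := if p.2 then Defs.ohead p.1 else otail p.1.

Definition tree_edge (e : tedge H) : edge G := inl (inl (inl e)).
Definition leaf_edge (x : leaf H) (i : bool) : edge G := inl (inl (inr (x, i))).
Definition pole_edge d (e : pedge (P d)) : edge G := inl (inr (existT _ d e)).
Definition side_edge (p : odart H * bool) (i : bool) : edge G := inr (p.1, (p.2, i)).

Lemma star_tree (v : vert (hgraph H)) :
  \big[op/idx]_(e | (inl (inl v) : vert G) \in ends e) f e =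
  op (\big[op/idx]_(e : tedge H | v \in ends (val e)) f (tree_edge e))
     (\big[op/idx]_(x : leaf H | val x == v)
        op (f (leaf_edge x false)) (f (leaf_edge x true))).
Proof.
rewrite big_star !big_sumType /=.
rewrite (big_notin op (I := {d : odart H & pedge (P d)})) => [|[]//].
rewrite (big_notin op (I := (odart H * (bool * bool))%type)) => [|[d [s i]] []//].
rewrite !Monoid.mulm1; congr (op _ _).
  rewrite [RHS]big_mkcond; apply: eq_bigr => e _.
  by rewrite -(big_ends op); apply: eq_bigl => b; rewrite !(inj_eq (@inl_inj _ _)).
rewrite big_pairE [RHS]big_mkcond; apply: eq_bigr => x _.
rewrite big_bool !big_bool_cond /= !Monoid.mul1m.
rewrite !(inj_eq (@inl_inj _ _)); case: eqP; rewrite ?Monoid.mulm1 // => _.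
exact: Monoid.mulmC.
Qed.

Lemma star_leaf_end (x : leaf H) i :
  \big[op/idx]_(e | (inl (inr (x, i)) : vert G) \in ends e) f e =
  op (f (leaf_edge x i)) (\big[op/idx]_(p | pole_leaf p == x) f (side_edge p i)).
Proof.
rewrite big_star !big_sumType /=.
rewrite (big_notin op (I := tedge H)) //.
rewrite (big_notin op (I := {d : odart H & pedge (P d)})) => [|[]//].
rewrite Monoid.mul1m Monoid.mulm1; congr (op _ _).
  rewrite -(big_pred1_eq op (x, i) (fun p : leaf H * bool => f (inl (inl (inr p))))) //.
  rewrite [RHS]big_mkcond; apply: eq_bigr => -[y j] _.
  rewrite big_mkcond big_bool /= Monoid.mulm1.
  by rewrite (inj_eq (@inl_inj _ _)) (inj_eq (@inr_inj _ _)).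
rewrite [RHS]big_mkcond !big_pairE; apply: eq_bigr => d _.
rewrite big_pairE; apply: eq_bigr => s _.
rewrite (bigD1 i) //= [X in op _ X]big1 => [|j ji]; rewrite big_mkcond big_bool /= Monoid.mulm1.
  rewrite ?Monoid.mulm1 (inj_eq (@inl_inj _ _)) (inj_eq (@inr_inj _ _)).
  by rewrite xpair_eqE eqxx andbT.
by rewrite (inj_eq (@inl_inj _ _)) (inj_eq (@inr_inj _ _)) xpair_eqE (negbTE ji) andbF.
Qed.

Lemma star_pole d (w : pvert (P d)) :
  \big[op/idx]_(e | (inr (existT _ d w) : vert G) \in ends e) f e =
  op (\big[op/idx]_(e : pedge (P d)) \big[op/idx]_(b | pendp e b == w) f (pole_edge e))
     (\big[op/idx]_s \big[op/idx]_(i | pdang (P d) s i == w) f (side_edge (d, s) i)).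
Proof.
have same (a b : pvert (P d)) :
    (existT (fun d => pvert (P d)) d a == existT _ d b) = (a == b).
  by rewrite -tag_eqE /tag_eq /= eqxx tagged_asE.
have diff d' (a : pvert (P d')) : d' != d ->
    (existT (fun d => pvert (P d)) d' a == existT _ d w) = false.
  by move=> dd; rewrite -tag_eqE /tag_eq /= (negbTE dd).
rewrite big_star !big_sumType /=.
rewrite [X in op (op (op X _) _) _]big_notin // [X in op (op (op _ X) _) _]big_notin => [|[] ? ? []//].
rewrite !Monoid.mul1m; congr (op _ _).
  rewrite big_sigmaE (bigD1 d) //= [X in op _ X]big1 => [|d' d'd].
    rewrite Monoid.mulm1; apply: eq_bigr => e _; apply: eq_bigl => b.
    by rewrite (inj_eq (@inr_inj _ _)) same.
  by rewrite big_notin // => e b; rewrite (inj_eq (@inr_inj _ _)) diff.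
rewrite big_pairE (bigD1 d) //= [X in op _ X]big1 => [|d' d'd].
  rewrite Monoid.mulm1 big_pairE; apply: eq_bigr => s _; rewrite [RHS]big_mkcond.
  apply: eq_bigr => i _; rewrite big_mkcond big_bool /= Monoid.mul1m.
  by rewrite (inj_eq (@inr_inj _ _)) same.
rewrite big_notin // => -[s i] [] //.
by rewrite (inj_eq (@inr_inj _ _)) diff.
Qed.
End TreelikeStars.
End Stars.

(** * Faces of a cubic Halin graph *)

Section Halin.
Variable H : halin.
Hypothesis cH : cubic (hgraph H).
Local Notation G := (hgraph H).
Local Notation T := (htree H).
Local Notation K := (hcircuit H).
Local Notation face := (porbit (hface H)).
Implicit Types (d : odart H) (a b : dart G) (e f : edge G) (v x y : vert G).

Lemma par_dart (f : edge G -> bool) v :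
  par f v = \big[addb/false]_(a : dart G | tail a == v) f a.1.
Proof. by rewrite /par pair_big_dep. Qed.

Lemma flipK : involutive (@flip G).
Proof. by case=> e b; rewrite /flip /= negbK. Qed.

Lemma tail_neq_head a : tail a != Defs.head a.
Proof.
by rewrite /Defs.head /tail /flip /=; have := endp_neq a.1; case: a => e [] //=; rewrite eq_sym.
Qed.

Lemma hfaceE a : hface H a = hrot H (flip a).
Proof. by rewrite /hface permM permE. Qed.

Lemma tail_hrot a : tail (hrot H a) = tail a.
Proof.
apply/eqP; have : hrot H a \in porbit (hrot H) a by rewrite -{1}[hrot H](@expg1 _) mem_porbit.
by rewrite hrotP inE.
Qed.

Lemma htree_forest : forest T.
Proof. exact: spanning_forest cH (htree_tree H). Qed.

Lemma htree_connect x y : connect (adj T) x y.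
Proof. by have /andP[/forallP/(_ x)/forallP] := htree_tree H. Qed.

(** It follows that an even edge function is determined by its values on [K]. *)
Lemma forest_par0 (f : edge G -> bool) :
  (forall v, par f v = false) -> (forall e, e \in K -> f e = false) -> f =1 xpred0.
Proof.
move=> f0 fK e; have /setP/(_ e) : [set e | f e] = set0; last by rewrite !inE.
apply: htree_forest.
  by apply/subsetP=> e'; rewrite inE; apply: contraLR => eT; rewrite fK // inE.
by move=> v; rewrite -[RHS](f0 v); apply: eq_par => e'; rewrite inE.
Qed.

Lemma outer_hcircuit a : a \in outer H -> a.1 \in K.
Proof.
move=> aO; have := outerP (h := H) a.1; case: (a.1 \in K) => //.
by move/eqP; rewrite cards_eq0 => /eqP/setP/(_ a); rewrite !inE aO eqxx.
Qed.

Lemma houter_outer : houter H \in outer H.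
Proof. exact: porbit_id. Qed.

Lemma outer_face a b : a \in outer H -> (b \in face a) = (b \in outer H).
Proof. by rewrite /outer -eq_porbit_mem => /eqP->. Qed.

Lemma outer_dart e : e \in K -> exists d, (val d).1 = e.
Proof.
move=> eK; have := outerP (h := H) e; rewrite eK => /eqP/cards1P[a /setP/(_ a)].
rewrite !inE eqxx => /andP[aO /eqP ae].
by exists (exist (fun a => a \in outer H) a aO).
Qed.

Lemma flip_outer d : flip (val d) \notin outer H.
Proof.
have := outerP (h := H) (val d).1; rewrite (outer_hcircuit (valP d)) => /eqP/cards1P[a E].
have dE : val d = a by apply/set1P; rewrite -E inE (valP d) eqxx.
apply/negP => fO; have /set1P : flip (val d) \in [set a] by rewrite -E !inE fO eqxx.
by rewrite -dE; case: (val d) => e [].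
Qed.

Lemma circuit_dart a : a.1 \in K -> exists d, a = val d \/ a = flip (val d).
Proof.
move=> /outer_dart[d dE]; exists d; move: dE; rewrite /flip.
by case: (val d) a => [e b] [f c] /= ->; case: b c => -[]; auto.
Qed.

Lemma outer_dart_inj d d' : (val d).1 = (val d').1 -> d = d'.
Proof.
move=> E; have [d'' [E'|E']] := circuit_dart (outer_hcircuit (valP d)).
  have := outerP (h := H) (val d).1; rewrite (outer_hcircuit (valP d)) => /eqP/cards1P[a Ea].
  apply: val_inj; have /set1P -> : val d \in [set a] by rewrite -Ea !inE (valP d) eqxx.
  by apply/esym/set1P; rewrite -Ea !inE (valP d') E eqxx.
by have := flip_outer d''; rewrite -E' (valP d).
Qed.

(** The edges that separate differently marked faces form an even set: [flip a] and [hrot H a] lie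
    on the same face, and [hrot] permutes the darts at [v], so the terms cancel. *)
Lemma par_face (p : dart G -> bool) v :
  (forall a, p (hface H a) = p a) -> par (fun e => p (e, false) (+) p (e, true)) v = false.
Proof.
move=> pf; rewrite par_dart.
rewrite (eq_bigr (fun a => p a (+) p (hrot H a))) => [|[e b] _]; last first.
  by rewrite -[in RHS](flipK (e, b)) -hfaceE pf /flip /=; case: b => //=; apply: addbC.
rewrite big_split /= [X in X (+) _](reindex_inj (@perm_inj _ (hrot H))) /=.
by under eq_bigl => a do rewrite tail_hrot; rewrite addbb.
Qed.

Lemma face_hface a : face (hface H a) = face a.
Proof. by apply/eqP; rewrite eq_porbit_mem -{1}[hface H](@expg1 _) mem_porbit. Qed.

(* A face of tree darts only would be a closed walk in the tree; the edges used
   once by it form an even set, so the walk uses each edge in both directions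
   and, turning at each vertex, reaches every dart. *)
Lemma inner_face a : a \notin outer H -> exists d, flip (val d) \in face a.
Proof.
move=> aO; apply/existsP; apply: contraT; rewrite negb_exists => /forallP noK.
have tr b : b \in face a -> b.1 \notin K.
  move=> ba; apply/negP => /circuit_dart[d [bd|bd]]; last first.
    by have := noK d; rewrite -bd ba.
  have bO : b \in outer H by rewrite bd (valP d).
  by move: aO; rewrite -(outer_face a bO) porbit_sym ba.
have inv b : (hface H b \in face a) = (b \in face a).
  by rewrite -!eq_porbit_mem face_hface.
have flip_in b : (flip b \in face a) = (b \in face a).
  have := @forest_par0 (fun e => ((e, false) \in face a) (+) ((e, true) \in face a)).
  move=> /(_ (fun v => par_face v inv)) H0.
  have /H0/(_ b.1) : forall e, e \in K -> ((e, false) \in face a) (+) ((e, true) \in face a) = false.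
    by move=> e eK; do 2![case: (boolP (_ \in face a)) => [/tr|_]; rewrite /= ?eK //].
  by case: b => e [] /=; rewrite /flip /=; do 2!case: (_ \in face a).
have rot_in b : (hrot H b \in face a) = (b \in face a).
  by rewrite -{1}(flipK b) -hfaceE inv flip_in.
have tail_in b c : tail b = tail c -> b \in face a -> c \in face a.
  move=> bc ba; have : c \in porbit (hrot H) b by rewrite hrotP inE bc.
  case/porbitP=> i ->; elim: i => [|i IH]; first by rewrite expg0 perm1.
  by rewrite expgSr permM rot_in.
(* The vertices met by the face are closed under tree adjacency, so the face reaches the tail of
   [houter], and then [houter] itself. *)
pose Q := [pred v | [exists b in face a, tail b == v]].
have : tail (houter H) \in Q.
  have cl : fingraph.closed (adj T) Q.
    apply: intro_closed; first exact: sym_connect_sym (adj_sym T).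
    move=> x y /adjP[e eT [c [xE yE]]] /exists_inP[b ba /eqP bx].
    apply/exists_inP; exists (flip (e, c)); last by rewrite -yE.
    by rewrite flip_in (tail_in b) // bx -xE.
  rewrite -(closed_connect cl (htree_connect (tail a) _)).
  by apply/exists_inP; exists a; rewrite ?porbit_id.
case/exists_inP => b ba /eqP /tail_in/(_ ba)/tr.
by rewrite (outer_hcircuit houter_outer).
Qed.

Lemma card_odart : #|{: odart H}| = #|K|.
Proof.
have -> : #|{: odart H}| = #|outer H| by rewrite card_sig; apply: eq_card => a; rewrite inE.
rewrite -!sum1_card (partition_big (fun a : dart G => a.1) (mem K)) => [|a /outer_hcircuit//].
apply: eq_bigr => e eK; rewrite sum1dep_card.
by rewrite outerP (eK : e \in K).
Qed.

(* Euler's formula leaves exactly as many inner faces as circuit edges. *)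
Lemma inner_face_inj : injective (fun d => face (flip (val d))).
Proof.
have cov : porbits (hface H) \subset outer H |: [set face (flip (val d)) | d : odart H].
  apply/subsetP=> _ /imsetP[a _ ->]; rewrite in_setU1.
  case: (boolP (a \in outer H)) => [|/inner_face[d da]].
    by rewrite /outer -eq_porbit_mem => ->.
  apply/orP; right; apply/imsetP; exists d => //.
  by apply/eqP; rewrite eq_sym eq_porbit_mem.
have KE : #|edge G| = #|T| + #|K| by rewrite -cardsT -(cardsID T) setTI setTD.
have := connected_card (proj1 (andP (htree_tree H))).
have := subset_leq_card cov; have := hplanar H; rewrite cardsU1.
set I := [set _ | _ in _] => euler le1 le2.
(* As |V| <= |T| + 1, there are at least |K| + 1 faces, and at most one of them lies outside [I]. *)
have le3 : #|{: odart H}| <= #|I| by rewrite card_odart; lia.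
have /imset_injP inj : #|I| == #|{: odart H}| by rewrite eqn_leq leq_imset_card.
by move=> d d'; apply: inj.
Qed.

(** Every inner face receives the label of its only circuit edge. The differences across edges are
    then even and agree with [S] on [K], hence everywhere. *)
Lemma face_labels (L : finType) (S : edge G -> {set L}) :
  (forall i v, par (fun e => i \in S e) v = false) ->
  exists Phi : dart G -> {set L},
  [/\ forall a b, b \in face a -> Phi b = Phi a,
      forall d, Phi (flip (val d)) = S (val d).1,
      forall a i, (i \in S a.1) = (i \in Phi a) (+) (i \in Phi (flip a))
    & forall a, a.1 \in T -> exists d, Phi a = S (val d).1].
Proof.
move=> S0.
(* The default [set0] is the label of the outer face, where the choice fails. *)
pose Phi a := if [pick d : odart H | flip (val d) \in face a] is Some d
  then S (val d).1 else set0.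
have PhiF a b : b \in face a -> Phi b = Phi a.
  by rewrite /Phi -eq_porbit_mem => /eqP->.
have Phid d : Phi (flip (val d)) = S (val d).1.
  rewrite /Phi; case: pickP => [d'|/(_ d)]; last by rewrite porbit_id.
  by rewrite -eq_porbit_mem => /eqP/inner_face_inj ->.
have PhiO a : a \in outer H -> Phi a = set0.
  move=> aO; rewrite /Phi; case: pickP => // d.
  by rewrite outer_face // (negbTE (flip_outer d)).
exists Phi; split=> // [a i|a aT].
  have Z : (fun e => (i \in S e) (+) ((i \in Phi (e, false)) (+) (i \in Phi (e, true)))) =1 xpred0.
    apply: forest_par0 => [v|e eK].
      rewrite par_add S0 /= (@par_face (fun a => i \in Phi a)) // => b.
      by rewrite (PhiF b) // -face_hface porbit_id.
    have [d dE] := outer_dart eK; have := PhiO _ (valP d); have := Phid d.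
    move: dE; case: (val d) => _ c /= ->; rewrite /flip /=.
    by case: c => -> ->; rewrite inE ?addbF ?addFb addbb.
  have := Z a.1; case: a => e [] /=; rewrite /flip /=.
    by do 3!case: (i \in _).
  by do 3!case: (i \in _).
have aO : a \notin outer H by apply/negP => /outer_hcircuit; rewrite inE aT.
rewrite /Phi; case: pickP => [d _|no]; first by exists d.
by have [d] := inner_face aO; rewrite no.
Qed.

Lemma inner_htree v e : v \notin leaves H -> v \in ends e -> e \in T.
Proof.
rewrite -hcircuit_leaves -leqNgt leqn0 cards_eq0 => /eqP/setP/(_ e).
by rewrite !inE => E ve; move: E; rewrite ve andbT => /negbFE.
Qed.

Lemma leaf_unique x e f : x \in leaves H -> e \in T -> f \in T ->
  x \in ends e -> x \in ends f -> e = f.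
Proof.
rewrite inE => /cards1P[g gE] eT fT xe xf.
by transitivity g; [|symmetry]; apply/set1P; rewrite -gE inE ?eT ?fT.
Qed.

(** Two leaves joined by a tree edge would make up the whole tree, which has more than two
    leaves. *)
Lemma leaf_inner a : a.1 \in T -> tail a \in leaves H -> Defs.head a \notin leaves H.
Proof.
move=> aT tl; apply/negP => hl.
have cl : fingraph.closed (adj T) [set tail a; Defs.head a].
  apply: intro_closed; first exact: sym_connect_sym (adj_sym T).
  move=> x y /adjP[e eT [c [xE yE]]]; rewrite !in_set2 => xa.
  have xe : x \in ends e by rewrite -xE imset_f.
  have ea : e = a.1.
    case/orP: xa => /eqP xa; rewrite xa in xe.
      exact: leaf_unique tl eT aT xe (tail_ends a).
    exact: leaf_unique hl eT aT xe (head_ends a).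
  have : y \in ends a.1 by rewrite -ea -yE imset_f.
  by rewrite (endsE _ a.2) !inE.
have := hleaves_gt2 H; rewrite ltnNge => /negP[].
apply: leq_trans (_ : #|[set tail a; Defs.head a]| <= 2); last by rewrite cards2; case: (_ != _).
apply: subset_leq_card; apply/subsetP=> x _.
by rewrite -(closed_connect cl (htree_connect (tail a) x)) set21.
Qed.

(* After the circuit dart, an inner face runs down a leaf edge and turns. *)
Lemma face_turn d : exists a b,
  [/\ a \in face (flip (val d)), b \in face (flip (val d)), a.1 != b.1,
      tail b = Defs.head a & Defs.head a \notin leaves H].
Proof.
pose a := hrot H (val d); pose b := hface H a.
have aF : a \in face (flip (val d)).
  by rewrite /a -{1}(flipK (val d)) -hfaceE -eq_porbit_mem face_hface.
have ta : tail a = tail (val d) by rewrite tail_hrot.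
have tb : tail b = Defs.head a by rewrite /b hfaceE tail_hrot.
(* Otherwise [a] is an outer dart or, by [inner_face_inj], equals [flip (val d)], which has a
   different tail. *)
have aT : a.1 \in T.
  apply: contraT => aK; have : a.1 \in K by rewrite inE.
  case/circuit_dart => d' [ad|ad].
    have := flip_outer d; rewrite -(outer_face _ (valP d')) -ad porbit_sym aF //.
  have /inner_face_inj dd : face (flip (val d')) = face (flip (val d)).
    by rewrite -ad; apply/eqP; rewrite eq_porbit_mem.
  by have := tail_neq_head (val d); rewrite -ta ad dd eqxx.
have hl : Defs.head a \notin leaves H.
  by apply: leaf_inner => //; rewrite ta (valP (otail d)).
exists a, b; split=> //.
  by rewrite -eq_porbit_mem face_hface eq_porbit_mem.
(* If the edges coincided, [flip a] would be fixed by the rotation and its tail would have degree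
   one. *)
apply/negP=> /eqP ab.
have : b = flip a.
  have : tail b <> tail a by rewrite tb => E; have := tail_neq_head a; rewrite E eqxx.
  by move: ab; case: (a) (b) => [e c] [f c'] /= ->; case: c c' => -[].
rewrite /b hfaceE => fixb.
have /forallP/(_ (tail (flip a)))/eqP := cH.
have one : porbit (hrot H) (flip a) = [set flip a].
  apply/setP=> c; rewrite inE; apply/porbitP/eqP => [[i ->]|->]; last first.
    by exists 0; rewrite expg0 perm1.
  by elim: i => [|i IH]; rewrite ?expg0 ?perm1 // expgSr permM IH.
have := hrotP (h := H) (flip a); rewrite one => starE.
rewrite /degree degin_sum => s3.
have : \sum_(c : dart G | tail c == tail (flip a)) 1 = 3.
  rewrite -s3 big_star pair_big_dep; apply: eq_big => // c _.
  by rewrite inE.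
by rewrite sum1dep_card -starE cards1.
Qed.
End Halin.

(** * A treelike snark has no tight labelling *)

Lemma card_symdiff (L : finType) (X Y : {set L}) :
  #|[set i | (i \in X) (+) (i \in Y)]| + 2 * #|X :&: Y| = #|X| + #|Y|.
Proof.
have cardE (A : {set L}) : #|A| = \sum_i (i \in A).
  by rewrite -sum1_card big_mkcond; apply: eq_bigr => i _; case: (i \in A).
rewrite !cardE big_distrr -!big_split /=; apply: eq_bigr => i _.
by rewrite !inE; case: (i \in X); case: (i \in Y).
Qed.

Section NoTight.
Variables (H : halin) (P : odart H -> fourpole) (k : nat).
Local Notation G := (treelike_graph P).
Variable S : edge G -> {set 'I_k}.
Hypotheses (cH : cubic (hgraph H)) (frP : forall d, frumious_pole (P d)).
Hypotheses (cG : cubic G) (k3 : 3 <= k) (tS : tight S).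
Implicit Types (d : odart H) (p : odart H * bool) (x : leaf H) (i : 'I_k) (j s : bool).

Local Notation side p j := (S (side_edge P p j)).
Local Notation top x j := (S (leaf_edge P x j)).

Definition jump d := [set i | (i \in side (d, false) false) (+) (i \in side (d, false) true)].

(** Summing parities over the vertices of the pole cancels its inner edges, so the sums on the two
    sides agree. *)
Lemma jumpE p i : (i \in jump p.1) = (i \in side p false) (+) (i \in side p true).
Proof.
pose f e := i \in S e.
suff E d : \big[addb/false]_(q : bool * bool) f (side_edge P (d, q.1) q.2) = false.
  have := E p.1; rewrite inE /f big_pairE !big_bool /=.
  by case: p => d []; do 4!case: (i \in _).
transitivity (\big[addb/false]_(w : pvert (P d))
  par f (inr (existT _ d w) : vert G)); last first.
  by apply: big1 => w _; case: tS => _ _; apply.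
under [RHS]eq_bigr => w _ do rewrite /par -big_star star_pole.
rewrite big_split /= exchange_big /= [X in X (+) _]big1 => [|e _]; last first.
  by rewrite big_fiber big_bool /= addbb.
rewrite big_pairE [in RHS]exchange_big /=; apply: eq_bigr => s _.
by rewrite big_fiber.
Qed.

Lemma card_jump p :
  exists c, #|jump p.1| + 2 * c = #|side p false| + #|side p true|.
Proof.
exists #|side p false :&: side p true|; rewrite -card_symdiff; congr (_ + _).
by apply: eq_card => i; rewrite jumpE inE.
Qed.

Definition closure_label d (e : edge (Defs.closure (P d))) : {set 'I_k} :=
  match e with
  | inl (inl e) => S (pole_edge e)
  | inl (inr (s, j)) => side (d, s) j
  | inr _ => jump d
  end.

Lemma closure_tight d : jump d != set0 ->
  (forall s, #|side (d, s) false| + #|side (d, s) true| + #|jump d| = 4) ->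
  tight (@closure_label d).
Proof.
case: (tS) => S0 S4 Sp D0 D4; split.
- by case=> [[e|[s j]]|[]] //=.
- case=> [w|s]; last by rewrite star_closure_end; exact: D4.
  by rewrite star_closure_pole -[RHS](S4 (inr (existT _ d w))) star_pole.
- move=> i; case=> [w|s]; rewrite /par -big_star.
    by rewrite star_closure_pole -[RHS](Sp i (inr (existT _ d w))) /par -big_star star_pole.
  by rewrite star_closure_end /= -(jumpE (d, s)) addbb.
Qed.

Definition singles p := (#|side p false| == 1) && (#|side p true| == 1).

(** In either excluded case the closure would be tight. If the jump has size 1, both sides have odd
    total, hence 3; if all four dangling edges are single, a nonempty jump has size 2. *)
Lemma pole_jump d : jump d != set0 ->
  #|jump d| != 1 /\ ~~ (singles (d, false) && singles (d, true)).
Proof.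
move=> D0; have D1 : 0 < #|jump d| by rewrite card_gt0.
have no4 : ~ forall s, #|side (d, s) false| + #|side (d, s) true| + #|jump d| = 4.
  move=> /(closure_tight D0); apply: frumious_not_tight k3; last exact: (frP d).2.
  exact: (inr false).
split; apply/negP.
  move=> /eqP D; case: no4 => s; have [c] := card_jump (d, s); rewrite D.
  have := tight_pos tS (side_edge P (d, s) false); have := tight_pos tS (side_edge P (d, s) true).
  have := tight_le2 cG tS (side_edge P (d, s) false); have := tight_le2 cG tS (side_edge P (d, s) true).
  by lia.
case/andP=> /andP[/eqP a /eqP b] /andP[/eqP a' /eqP b']; case: no4 => s.
by have [c] := card_jump (d, s); move: D1 a b a' b'; case: s => /=; lia.
Qed.

(** Cubicity at the vertex (x, false) leaves room for exactly two sides at [x]. *)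
Lemma leaf_sides x : exists p q, pole_leaf p = x /\ pole_leaf q = x /\
  forall (R : Type) (idx : R) (op : Monoid.com_law idx) F,
  \big[op/idx]_(p | pole_leaf p == x) F p = op (F p) (F q).
Proof.
have := sum_cubic (inl (inr (x, false)) : vert G) cG.
rewrite star_leaf_end sum1dep_card /= add1n => /eqP; rewrite eqSS => /cards2P[p [q [pq E]]].
exists p, q; have /setP/(_ p) := E; have /setP/(_ q) := E.
rewrite !inE !eqxx orbT => /eqP qx /eqP px; split=> //; split=> // R idx op F.
rewrite (eq_bigl (mem [set p; q])) => [|r]; last by rewrite /= -E inE.
by rewrite big_setU1 ?inE //= big_set1.
Qed.

Lemma leaf_edge_label x j i :
  (i \in top x j) = \big[addb/false]_(p | pole_leaf p == x) (i \in side p j).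
Proof.
have [_ _ /(_ i (inl (inr (x, j)) : vert G))] := tS.
by rewrite /par -big_star star_leaf_end /=; case: (\big[_/_]_(_ | _) _); case: (_ \in _).
Qed.

(** The labelling carried over to the Halin graph, with a circuit edge labelled by the jump of its
    pole. The default [set0] does not occur, since every edge outside the tree carries an outer
    dart. *)
Definition halin_label (e : edge (hgraph H)) : {set 'I_k} :=
  if insub e is Some te then S (tree_edge P te)
  else if [pick d : odart H | (val d).1 == e] is Some d then jump d else set0.

Lemma halin_label_tree (te : tedge H) : halin_label (val te) = S (tree_edge P te).
Proof. by rewrite /halin_label valK. Qed.

Lemma halin_label_dart d : halin_label (val d).1 = jump d.
Proof.
rewrite /halin_label insubN; last by have := outer_hcircuit (valP d); rewrite inE.
by case: pickP => [d' /eqP/outer_dart_inj->|/(_ d)]; rewrite ?eqxx.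
Qed.

(** At a leaf, the labels of the two leaf edges sum to the jumps of the poles at that leaf. *)
Lemma halin_label_even i v : par (fun e => i \in halin_label e) v = false.
Proof.
have [_ _ /(_ i (inl (inl v) : vert G))] := tS.
rewrite /par -!big_star star_tree => E; rewrite -[RHS]E {E}.
rewrite (bigID (mem (htree H))) /=; congr (_ (+) _).
  transitivity (\big[addb/false]_(e in htree H | e \in [pred e | v \in ends e])
    (i \in halin_label e)); first by apply: eq_bigl => e; rewrite inE andbC.
  rewrite big_sub_cond; apply: eq_big => [te|te _]; first by rewrite inE.
  by rewrite halin_label_tree.
transitivity (\big[addb/false]_(p | val (pole_leaf p) == v) (i \in jump p.1)); last first.
  rewrite (partition_big (@pole_leaf H) (fun x => val x == v)) //=.
  apply: eq_bigr => x xv; rewrite !leaf_edge_label -big_split /=.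
  apply: eq_big => [p|p _]; last exact: jumpE.
  by case: (pole_leaf p =P x) => [->|_]; rewrite ?andbT ?andbF ?xv.
rewrite [RHS]big_mkcond big_pairE.
have pickE e : e \notin htree H ->
    omap (fun d => (val d).1) [pick d : odart H | (val d).1 == e] = Some e.
  move=> eT; have [|d dE] := @outer_dart H e; first by rewrite inE.
  by case: pickP => [d' /eqP <- //|/(_ d)]; rewrite dE eqxx.
rewrite (reindex_omap (fun d => (val d).1) (fun e => [pick d : odart H | (val d).1 == e]))
  => [|e /andP[_ /pickE//]].
rewrite big_mkcond; apply: eq_bigr => d _.
have -> : [pick d' | (val d').1 == (val d).1] == Some d.
  by case: pickP => [d' /eqP/outer_dart_inj->//|/(_ d)]; rewrite eqxx.
have dK : (val d).1 \notin htree H by have := outer_hcircuit (valP d); rewrite inE.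
rewrite dK !andbT halin_label_dart -big_mkcond big_bool_cond /= in_ends.
rewrite /tail /Defs.head /tail /flip /=.
have : ~~ ((endp (val d).1 true == v) && (endp (val d).1 false == v)).
  by apply/negP => /andP[/eqP<-]; apply/negP; apply: endp_neq.
by rewrite -[sval d]/(val d); case: (val d) => e [] /=; case: (endp e true == v); case: (endp e false == v); case: (i \in _).
Qed.

Lemma tree_edge_end e (eT : e \in htree H) v : v \in ends e ->
  (inl (inl v) : vert G) \in ends (tree_edge P (exist (fun e => e \in htree H) e eT)).
Proof. by rewrite !in_ends. Qed.

(** The two tree edges of [face_turn] share a vertex, where only one edge can be doubled. *)
Lemma single_on_face d : exists2 a, a \in porbit (hface H) (flip (val d)) &
  a.1 \in htree H /\ #|halin_label a.1| = 1.
Proof.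
have [a [b [aF bF ab tb hl]]] := face_turn cH d.
have aT : a.1 \in htree H by apply: inner_htree hl (head_ends a).
have bT : b.1 \in htree H by apply: inner_htree hl _; rewrite -tb tail_ends.
have va := tree_edge_end aT (head_ends a).
have vb : (inl (inl (Defs.head a)) : vert G) \in ends (tree_edge P (exist (fun e => e \in htree H) _ bT)).
  by apply: tree_edge_end; rewrite -tb tail_ends.
have ne : tree_edge P (exist (fun e => e \in htree H) _ aT) != tree_edge P (exist (fun e => e \in htree H) _ bT).
  by apply: contraNneq ab => -[->].
have [g [_ _ s4 _]] := tight_third cG tS ne va vb.
have := tight_pos tS (tree_edge P (exist (fun e => e \in htree H) _ aT)).
have := tight_pos tS (tree_edge P (exist (fun e => e \in htree H) _ bT)).
have := tight_pos tS g; move: s4.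
rewrite -(halin_label_tree (exist (fun e => e \in htree H) _ aT)).
rewrite -(halin_label_tree (exist (fun e => e \in htree H) _ bT)) /=.
have arith m n l : m + (n + l) = 4 -> 0 < l -> 0 < n -> 0 < m -> m = 1 \/ n = 1 by lia.
move=> s4 g0 b0 a0; have [a1|b1] := arith _ _ _ s4 g0 b0 a0.
  by exists a.
by exists b.
Qed.

Lemma jump_neq0 d : jump d != set0.
Proof.
have [Phi [PhiF Phid PhiE PhiT]] := face_labels cH halin_label_even.
have [a aF [aT a1]] := single_on_face d.
apply/negP => /eqP D0.
(* With an empty label on this face, the label of the single edge is the jump of the face across
   it. *)
have aE : halin_label a.1 = Phi (flip a).
  apply/setP=> i; rewrite PhiE (PhiF _ _ aF) Phid halin_label_dart D0 inE //.
have [d' d'E] := PhiT (flip a) aT.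
have d'1 : #|jump d'| = 1 by rewrite -halin_label_dart -d'E -aE.
have /pole_jump[] : jump d' != set0 by rewrite -card_gt0 d'1.
by rewrite d'1.
Qed.

Definition evenj d := ~~ odd #|jump d|.

(** The sum has one term, since a leaf has a single tree edge. *)
Definition stem x := \sum_(e : tedge H | val x \in ends (val e)) #|S (tree_edge P e)|.

(** If the stem is single, one side at [x] has two single edges and the other a single and a double
    one. If it is double, either one side is all single and the other all double, or both are mixed.
    The inequality is an equality in each case. *)
Lemma leaf_count x : exists p q, [/\ pole_leaf p = x, pole_leaf q = x,
  forall (R : Type) (idx : R) (op : Monoid.com_law idx) F,
    \big[op/idx]_(p | pole_leaf p == x) F p = op (F p) (F q),
  stem x != 1 -> evenj p.1 = evenj q.1 &
  evenj p.1 + evenj q.1 + (stem x == 1) <= 2 * (singles p + singles q)].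
Proof.
have [p [q [px [qx E]]]] := leaf_sides x; exists p, q.
have sum_at j : #|top x j| + (#|side p j| + #|side q j|) = 4.
  case: tS => _ /(_ (inl (inr (x, j)))) <- _.
  by rewrite star_leaf_end E.
have stem4 : stem x + (#|top x false| + #|top x true|) = 4.
  case: tS => _ /(_ (inl (inl (val x)))) <- _.
  by rewrite star_tree (big_pred1 x).
have stem0 : 0 < stem x.
  have := valP x; rewrite inE => /cards1P[e /setP/(_ e)].
  rewrite !inE eqxx => /andP[eT xe].
  by rewrite /stem (bigD1 (exist (fun e => e \in htree H) e eT)) //= addn_gt0 (tight_pos tS).
have evE r : evenj r.1 = ~~ odd (#|side r false| + #|side r true|).
  by have [c <-] := card_jump r; rewrite oddD mul2n odd_double addbF.
rewrite !evE /singles.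
have := sum_at false; have := sum_at true; move: stem4 stem0.
have := tight_pos tS (leaf_edge P x false); have := tight_pos tS (leaf_edge P x true).
have := tight_pos tS (side_edge P p false); have := tight_pos tS (side_edge P p true).
have := tight_pos tS (side_edge P q false); have := tight_pos tS (side_edge P q true).
have := tight_le2 cG tS (side_edge P p false); have := tight_le2 cG tS (side_edge P p true).
have := tight_le2 cG tS (side_edge P q false); have := tight_le2 cG tS (side_edge P q true).
move: (stem x) #|top x false| #|top x true| #|side p false| #|side p true| #|side q false| #|side q true|.
move=> t u v a b c d.
case: d => [|[|[|d]]] // _; case: c => [|[|[|c]]] // _.
- case: b => [|[|[|b]]] // _; case: a => [|[|[|a]]] // _ _ _ _ _ *; split=> //; lia.
- case: b => [|[|[|b]]] // _; case: a => [|[|[|a]]] // _ _ _ _ _ *; split=> //; lia.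
- case: b => [|[|[|b]]] // _; case: a => [|[|[|a]]] // _ _ _ _ _ *; split=> //; lia.
- case: b => [|[|[|b]]] // _; case: a => [|[|[|a]]] // _ _ _ _ _ *; split=> //; lia.
Qed.

Lemma evenj_stem p q : pole_leaf p = pole_leaf q -> stem (pole_leaf p) != 1 ->
  evenj p.1 = evenj q.1.
Proof.
move=> pq; have [p' [q' [p'x q'x E ev _]]] := leaf_count (pole_leaf p) => /ev{}ev.
have mem r : pole_leaf r = pole_leaf p -> r = p' \/ r = q'.
  (* The sum formula for disjunction says that [p'] and [q'] are the only sides at this leaf. *)
  move=> rx; have := E _ _ orb (pred1 r).
  rewrite /= big_has_cond => H'; have : (p' == r) || (q' == r).
    by rewrite -H'; apply/hasP; exists r; rewrite ?mem_index_enum //= rx !eqxx.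
  by case/orP => /eqP->; auto.
by have [->|->] := mem p erefl; have [->|->] := mem q (esym pq).
Qed.

(** Otherwise the parity of the jumps is constant along the circuit, so every tree label, a
    difference of two jumps, has even size, against [single_on_face]. *)
Lemma single_stem : exists x, stem x = 1.
Proof.
suff : [exists x, stem x == 1] by case/existsP=> x /eqP; exists x.
apply: contraT; rewrite negb_exists => /forallP no1.
have d0 : odart H by exists (houter H); apply: houter_outer.
have ends_pole d v : v \in ends (val d).1 -> exists2 p, p.1 = d & val (pole_leaf p) = v.
  rewrite (endsE _ (val d).2) => /set2P[->|->].
    by exists (d, false).
  by exists (d, true).
have allev d : evenj d = evenj d0.
  pose Q := [pred v | [forall p, (val (pole_leaf p) == v) ==> (evenj p.1 == evenj d0)]].
  have prop p v : val (pole_leaf p) = v -> evenj p.1 = evenj d0 -> v \in Q.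
    move=> pv p0; apply/forallP=> q; apply/implyP=> /eqP qv.
    rewrite -p0; apply/eqP/evenj_stem; last exact: no1.
    by apply: val_inj; rewrite qv pv.
  have cl : fingraph.closed (adj (hcircuit H)) Q.
    apply: intro_closed; first exact: sym_connect_sym (adj_sym _).
    move=> x y /adjP[e eK [c [xE yE]]] /forallP Qx.
    have [d' d'E] := outer_dart eK.
    have [|px pd pxE] := ends_pole d' x; first by rewrite d'E -xE imset_f.
    have [|py pd' pyE] := ends_pole d' y; first by rewrite d'E -yE imset_f.
    apply: (prop py) => //; rewrite pd' -pd; apply/eqP.
    by have := Qx px; rewrite pxE eqxx.
  have deg d' : 0 < degin (hcircuit H) (tail (val d')).
    by rewrite hcircuit_leaves (valP (otail d')).
  have /and3P[_ _ /forallP/(_ (tail (val d0)))/forallP/(_ (tail (val d)))] := hcircuit_circuit H.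
  rewrite !deg /= => /(closed_connect cl) => E.
  have : tail (val d) \in Q by rewrite -E; apply: (prop (d0, false)).
  by move=> /forallP/(_ (d, false)); rewrite eqxx => /eqP.
have [Phi [PhiF Phid PhiE PhiT]] := face_labels cH halin_label_even.
have [a aF [aT a1]] := single_on_face d0.
have [d1 d1E] := PhiT a aT; have [d2 d2E] := PhiT (flip a) aT.
have := card_symdiff (jump d1) (jump d2).
have -> : [set i | (i \in jump d1) (+) (i \in jump d2)] = halin_label a.1.
  by apply/setP=> i; rewrite inE PhiE d1E d2E !halin_label_dart.
rewrite a1 => /(congr1 odd); rewrite mul2n [odd (1 + _)]oddD odd_double oddD /=.
have := allev d1; rewrite -(allev d2) /evenj => /negb_inj ->.
by rewrite addbb.
Qed.

(* Both sides of the contradiction count pole sides: by leaves, twice the sides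
   with two singly covered edges exceed the sides of poles with even jump; by
   poles, they do not. *)
Lemma treelike_not_tight : False.
Proof.
have [x0 x01] := single_stem.
pose ev p := (evenj p.1 : nat); pose sg p := 2 * singles p.
have byleaf F : \sum_p F p = \sum_(x : leaf H) \sum_(p | pole_leaf p == x) F p.
  by rewrite (partition_big (@pole_leaf H) xpredT).
(* The inequality of [leaf_count] is strict at [x0], whose stem is single. *)
have lt : \sum_p ev p < \sum_p sg p.
  have le x : \sum_(p | pole_leaf p == x) ev p + (stem x == 1)
      <= \sum_(p | pole_leaf p == x) sg p.
    have [p [q [_ _ E _ le]]] := leaf_count x.
    by rewrite !E /= /ev /sg -mulnDr.
  rewrite !byleaf (bigD1 x0) //= [X in _ < X](bigD1 x0) //= -addSn leq_add //.
    by have := le x0; rewrite x01 eqxx addn1.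
  by apply: leq_sum => x _; apply: leq_trans (le x); apply: leq_addr.
have : \sum_p sg p <= \sum_p ev p.
  (* A pole has at most one side with two single edges, and such a side makes its jump even. *)
  rewrite !big_pairE; apply: leq_sum => d _; rewrite !big_bool /sg /ev /=.
  have [_ both] := pole_jump (jump_neq0 d).
  have sev s : singles (d, s) -> evenj d.
    case/andP=> /eqP a /eqP b; rewrite /evenj; have [c] := card_jump (d, s).
    by rewrite a b => /(congr1 odd); rewrite oddD mul2n odd_double addbF /= => ->.
  move: both (sev false) (sev true); case: (singles _); case: (singles _); case: (evenj d) => //=.
  - by move=> _ /(_ isT).
  - by move=> _ _ /(_ isT).
by rewrite leqNgt lt.
Qed.
End NoTight.

(** * Treelike snarks have cycle covers *)

Section Cover.
Variables (H : halin) (P : odart H -> fourpole).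
Local Notation G := (treelike_graph P).
Hypotheses (cH : cubic (hgraph H)) (frP : forall d, frumious_pole (P d)) (cG : cubic G).
Local Notation T := (htree H).
Implicit Types (d : odart H) (p : odart H * bool) (x : leaf H) (j s : bool).

Section Extend.
Variables (d : odart H) (C : {set edge (Defs.closure (P d))}) (J : {set edge (hgraph H)}).
Hypothesis evC : even_set C.
Hypothesis JT : J \subset T.
Hypothesis parJ : forall v,
  par [in J] v = (tail (val d) == v) (+) (Defs.head (val d) == v).

(* A cycle of the closure through uv crosses the pole; outside, it is closed
   up by a path [J] of the tree between the two leaves at the pole. *)
Definition extend : {set edge G} := [set e : edge G |
  match e with
  | inl (inl (inl e)) => (inr tt \in C) && (val e \in J)
  | inl (inl (inr (x, j))) => \big[addb/false]_(s | pole_leaf (d, s) == x) (inl (inr (s, j)) \in C)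
  | inl (inr e) => [exists e' : pedge (P d), (e == existT _ d e') && (inl (inl e') \in C)]
  | inr (d', (s, j)) => (d' == d) && (inl (inr (s, j)) \in C)
  end].

Lemma extend_pole_edge e : (pole_edge e \in extend) = (inl (inl e) \in C).
Proof.
rewrite inE /=; apply/existsP/idP => [[e' /andP[/eqP E]]|eC]; last by exists e; rewrite eqxx.
suff -> : e = e' by [].
by apply/eqP; have /eqP := E; rewrite -tag_eqE /tag_eq /= eqxx tagged_asE.
Qed.

Lemma side_even s :
  (inl (inr (s, false)) \in C) (+) (inl (inr (s, true)) \in C) = (inr tt \in C).
Proof.
have := evC (inr s); rewrite /par -big_star star_closure_end /=.
by do 3!case: (_ \in C).
Qed.

Lemma side_edge_extend p j :
  (side_edge P p j \in extend) = (p.1 == d) && (inl (inr (p.2, j)) \in C).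
Proof. by rewrite inE. Qed.

Lemma leaf_edge_extend x j :
  (leaf_edge P x j \in extend) =
  \big[addb/false]_(s | pole_leaf (d, s) == x) (inl (inr (s, j)) \in C).
Proof. by rewrite inE. Qed.

Lemma tree_edges_extend v :
  \big[addb/false]_(e : tedge H | v \in ends (val e)) (tree_edge P e \in extend) =
  (inr tt \in C) && par [in J] v.
Proof.
transitivity (\big[addb/false]_(e : tedge H | v \in ends (val e)) ((inr tt \in C) && (val e \in J))).
  by apply: eq_bigr => e _; rewrite inE.
case: (inr tt \in C); last by rewrite big1.
rewrite /par -big_star [RHS](bigID (mem T)) /= [X in _ = _ (+) X]big1 => [|e /andP[_ eT]]; last first.
  by apply: contraNF eT => /(subsetP JT).
rewrite addbF; transitivity (\big[addb/false]_(e in T | e \in [pred e | v \in ends e]) (e \in J)).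
  by rewrite big_sub_cond; apply: eq_bigl => e; rewrite inE.
by apply: eq_bigl => e; rewrite inE andbC.
Qed.

(** At each of the two leaves of the pole, the leaf edges in the extension have the parity of uv,
    which cancels the boundary of [J]. *)
Lemma extend_even : even_set extend.
Proof.
case=> [[v|[x j]]|[d' w]]; rewrite /par -big_star.
- rewrite star_tree /= tree_edges_extend parJ.
  transitivity ((inr tt \in C) && ((tail (val d) == v) (+) (Defs.head (val d) == v)) (+)
      \big[addb/false]_(s | val (pole_leaf (d, s)) == v) (inr tt \in C)).
    congr (_ (+) _).
    rewrite [RHS](partition_big (fun s => pole_leaf (d, s)) (fun x => val x == v)) //=.
    apply: eq_bigr => x xv; rewrite !leaf_edge_extend -big_split /=.
    apply: eq_big => [s|s _]; last exact: side_even.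
    by case: (pole_leaf (d, s) =P x) => [->|_]; rewrite ?andbT ?andbF ?xv.
  rewrite big_bool_cond /=.
  by case: (_ \in C); case: (_ == v); case: (_ == v).
- rewrite star_leaf_end /= leaf_edge_extend.
  have -> : \big[addb/false]_(p | pole_leaf p == x) (side_edge P p j \in extend) =
      \big[addb/false]_(s | pole_leaf (d, s) == x) (inl (inr (s, j)) \in C).
    rewrite big_mkcond big_pairE (bigD1 d) //= [X in _ (+) X]big1 => [|d' d'd].
      by rewrite addbF -big_mkcond; apply: eq_bigr => s _; rewrite side_edge_extend eqxx.
    by rewrite big1 // => s _; rewrite side_edge_extend (negbTE d'd); case: ifP.
  by rewrite addbb.
- rewrite star_pole /=.
  have [E|ne] := eqVneq d' d; last first.
    rewrite big1 => [|e _].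
      by rewrite big1 // => s _; rewrite big1 // => i _; rewrite side_edge_extend (negbTE ne).
    rewrite big1 // => b _; rewrite inE /=; apply/existsP => -[e' /andP[/eqP E _]].
    by case/eqP: ne; case: E.
  subst d'; rewrite -[RHS](evC (inl w)) /par -big_star star_closure_pole /=.
  congr (_ (+) _).
    by apply: eq_bigr => e _; apply: eq_bigr => b _; rewrite extend_pole_edge.
  by apply: eq_bigr => s _; apply: eq_bigr => i _; rewrite side_edge_extend eqxx.
Qed.
End Extend.

(** Removing [e] splits the tree into [A] and its complement. Both parts contain leaves, so some
    circuit edge crosses, and a join of its ends within the tree must use [e]. *)
Lemma tree_edge_join e : e \in T -> exists d, forall J : {set edge (hgraph H)},
  J \subset T ->
  (forall v, par [in J] v = (tail (val d) == v) (+) (Defs.head (val d) == v)) -> e \in J.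
Proof.
move=> eT; pose F := T :\ e.
pose A := [set v | connect (adj F) (endp e false) v].
have pA : endp e false \in A by rewrite inE connect0.
have qA : endp e true \notin A.
  rewrite inE; apply/negP => /join[J JF Jv].
  have eJ : e \notin J by apply/negP => /(subsetP JF); rewrite !inE eqxx.
  have /setP/(_ e) : symdiff J [set e] = set0; last by rewrite !inE eqxx (negbTE eJ).
  apply: (htree_forest cH).
    by rewrite symdiff_sub ?sub1set // (subset_trans JF) // subD1set.
  move=> v; rewrite par_symdiff Jv (@eq_par _ [in [set e]] (pred1 e)); last by move=> f; rewrite /= inE.
  rewrite par_edge in_ends; have : ~~ ((endp e false == v) && (endp e true == v)).
    by apply/negP => /andP[/eqP<-]; apply/negP; rewrite eq_sym; apply: endp_neq.
  by case: (_ == v); case: (_ == v).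
have cut f b : f \in T -> f != e -> endp f b \in A -> endp f (~~ b) \in A.
  move=> fT fe; rewrite !inE => /connect_trans; apply; apply: connect1; apply/adjP.
  by exists f; [rewrite !inE fe | exists b].
have cutE f : f \in T -> f != e -> (endp f false \in A) = (endp f true \in A).
  by move=> fT fe; apply/idP/idP; [apply: (cut f false) | apply: (cut f true)].
have [/existsP[d dA]|/existsPn same] := boolP
    [exists d : odart H, (tail (val d) \in A) (+) (Defs.head (val d) \in A)].
  (* By the handshake identity, [J] has an odd number of edges across the cut, and [e] is the only
     tree edge there. *)
  exists d => J JT Jv; apply: contraLR dA => eJ.
  have mem_sum (u : vert (hgraph H)) : \big[addb/false]_(v in A) (u == v) = (u \in A).
    rewrite big_mkcond (bigD1 u) //= eqxx big1 ?addbF => [|v].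
      by case: (u \in A).
    by rewrite eq_sym => /negbTE->; case: (v \in A).
  rewrite -!mem_sum -big_split /=; under eq_bigr => v _ do rewrite -Jv.
  rewrite handshake big1 // => f _; case: (boolP (f \in J)) => //= fJ.
  have fe : f != e by apply: contraNneq eJ => <-.
  by rewrite (cutE f) ?(subsetP JT) // addbb.
have d0 : odart H by exists (houter H); apply: houter_outer.
have cl : fingraph.closed (adj (hcircuit H)) A.
  apply: intro_closed; first exact: sym_connect_sym (adj_sym _).
  move=> x y /adjP[f fK [b [<- <-]]].
  have [d dE] := outer_dart fK; have := same d; rewrite -dE.
  rewrite /tail /Defs.head /tail /flip /=; case: (sval d).2 b => -[] /=;
    by do 2!case: (_ \in A).
have leafA y : y \in leaves H -> (y \in A) = (tail (val d0) \in A).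
  move=> yl; suff yd : connect (adj (hcircuit H)) y (tail (val d0)) by rewrite (closed_connect cl yd).
  have /and3P[_ _ /forallP/(_ y)/forallP/(_ (tail (val d0)))] := hcircuit_circuit H.
  by rewrite !hcircuit_leaves yl (valP (otail d0)).
(* If no circuit edge crosses, all leaves lie on one side; [B] is the other. Some vertex of [B] has
   at most one tree edge inside [B], hence with [e] at most two edges in all, against cubicity. *)
pose B := [set v | (v \in A) != (tail (val d0) \in A)].
have B0 : B != set0.
  apply/set0Pn; case: (boolP (tail (val d0) \in A)) => dA.
    by exists (endp e true); rewrite inE (negbTE qA) dA.
  by exists (endp e false); rewrite inE pA (negbTE dA).
have [v vB] := forest_low (htree_forest cH) B0; rewrite leqNgt => /negP[].
have vl : v \notin leaves H.
  by apply/negP => /leafA vA; move: vB; rewrite inE vA eqxx.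
have := sum_cubic v cH; rewrite sum1dep_card => s3.
have : [set h | v \in ends h] \subset e |: [set h in T | (v \in ends h) && (ends h \subset B)].
  apply/subsetP=> h; rewrite !inE => vh; case: eqVneq => //= he.
  have hT := inner_htree vl vh; rewrite hT vh /=.
  have hA u w : u \in ends h -> w \in ends h -> (u \in A) = (w \in A).
    by rewrite !in_ends => /orP[]/eqP<- /orP[]/eqP<- //; rewrite (cutE h).
  by apply/subsetP=> u uh; rewrite inE (hA u v) //; move: vB; rewrite inE.
move/subset_leq_card; rewrite s3 cardsU1; by case: (_ \notin _); lia.
Qed.

Lemma pole_tree_path d : exists2 J : {set edge (hgraph H)}, J \subset T &
  forall v, par [in J] v = (tail (val d) == v) (+) (Defs.head (val d) == v).
Proof. exact/join/htree_connect. Qed.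

Lemma closure_cycle d (e : edge (Defs.closure (P d))) : exists2 C, even_set C & e \in C.
Proof.
apply: bridgeless_cycle; have [_ [/andP[_ /forallP/(_ e)]]] := frP d.
by [].
Qed.

Lemma treelike_cycle (e : edge G) : exists2 C, even_set C & e \in C.
Proof.
case: e => [[[e|[x j]]|[d e]]|[d [s j]]].
- have [d dP] := tree_edge_join (valP e).
  have [J JT Jv] := pole_tree_path d; have [C Cev uvC] := closure_cycle (inr tt : edge (Defs.closure (P d))).
  exists (extend C J); first exact: extend_even.
  by rewrite inE uvC dP.
- have [p [q [px _]]] := leaf_sides cG x.
  have [J JT Jv] := pole_tree_path p.1.
  have [C Cev uC] := closure_cycle (inl (inr (p.2, j)) : edge (Defs.closure (P p.1))).
  exists (extend C J); first exact: extend_even.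
  (* The two sides of a pole end at different leaves, so only the term of side [p.2] remains. *)
  rewrite leaf_edge_extend (big_pred1 p.2) // => s; rewrite -px /pole_leaf.
  have := tail_neq_head (val p.1); case: p {px C Cev uC J JT Jv} => d t /= ne.
  apply/eqP/eqP => [|->//] /(congr1 val); case: s t => -[] //= E.
    by move: ne; rewrite -E eqxx.
  by move: ne; rewrite E eqxx.
- have [J JT Jv] := pole_tree_path d; have [C Cev eC] := closure_cycle (inl (inl e) : edge (Defs.closure (P d))).
  exists (extend C J); first exact: extend_even.
  by rewrite (extend_pole_edge C J e).
- have [J JT Jv] := pole_tree_path d.
  have [C Cev eC] := closure_cycle (inl (inr (s, j)) : edge (Defs.closure (P d))).
  exists (extend C J); first exact: extend_even.
  by rewrite (side_edge_extend C J (d, s) j) eqxx.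
Qed.
End Cover.

Theorem corollary5p7 (G : mgraph) (hG : treelike_snark G) :
  exists2 n : nat, scc G = Some n
    & (4%:R / 3%:R * #|edge G|%:R < n%:R :> rat)%R.
Proof.
case: hG => cG [H [P [cH frP iso]]].
have cT := isomorphic_cubic iso cG.
have [Ds covD] := cover_of_cycles (treelike_cycle cH frP cT).
have [Cs covC _] := isomorphic_cover (isomorphic_sym iso) covD.
have [n nE] : exists n, scc G = Some n.
  by apply: (@minimum_ex _ (cover_length Cs)); exists Cs.
exists n => //; have [[Bs covB lenB] _] := minimumP nE.
(* A shorter optimal cover would carry over to the treelike graph and give it a tight labelling. *)
have lt : 4 * #|edge G| < 3 * n.
  rewrite ltnNge; apply/negP => short.
  have [As covA lenA] := isomorphic_cover iso covB.
  have [|k [S [k3 tS]]] := short_cover_tight cT covA.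
    by rewrite lenA lenB -(isomorphic_edges iso).
  exact: (treelike_not_tight cH frP cT k3 tS).
have : ((4 * #|edge G|)%:R < (3 * n)%:R :> rat)%R by rewrite Num.Theory.ltr_nat.
rewrite !GRing.natrM => lt'.
by rewrite -GRing.mulrA GRing.mulrCA Num.Theory.ltr_pdivrMl.
Qed.
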